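(* Let $C\subset\mathbb{R}^3$ be the image of an embedded regular curve defined on a bounded closed interval, of length $l>0$ and with nowhere vanishing curvature, and let $\Gamma\subset\mathbb{R}^2$ be the image of an arc-length parametrized regular plane curve $\gamma:[-l/2,l/2]\to\mathbb{R}^2$ without self-intersections. Assume $\mathcal{P}_*(\Gamma,|C|)$ is non-empty, and let $N$ be the number of congruence classes of curved foldings in $\mathcal{P}_*(\Gamma,|C|)$. Then: (1) if $C$ has no symmetries and $\Gamma$ has no symmetries, then $N=4$; (2) otherwise $N\le 2$; (3) $N=1$ if and only if one of the following holds: (a) $C$ lies in a plane and has a non-trivial symmetry; (b) $C$ lies in a plane and $\Gamma$ has a symmetry; (c) $C$ does not lie in any plane, $C$ has a positive symmetry, and $\Gamma$ has a symmetry.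
   Context: Orientation: $C$ carries an orientation; $-C$ is $C$ with the opposite orientation and $|C|$ the unoriented curve. Let $J=[-l/2,l/2]$ and $\mathbf c:J\to\mathbb R^3$ an arc-length parametrization of $C$ inducing its orientation. For a regular parametrization $\mathbf c_f$ of $C$ we use its curvature $\kappa_f$, torsion $\tau_f$ and Frenet frame $(\mathbf e,\mathbf n,\mathbf b)$. Developable strips: a developable strip along $C$ is the germ along $C$ of a $C^\infty$ embedding $f(u,v)=f(u,0)+v\,\xi_f(u)$ defined on a neighbourhood of $J_0\times\{0\}$ in $J_0\times\mathbb R$ ($J_0$ a closed interval) such that $\mathbf c_f(u):=f(u,0)$ parametrizes $C$, $\xi_f$ is a unit vector field, and the Gaussian curvature of $f$ vanishes identically. Write $\xi_f=\cos\beta_f\,\mathbf e+\sin\beta_f(\cos\alpha_f\,\mathbf n+\sin\alpha_f\,\mathbf b)$ with the Frenet frame of $\mathbf c_f$. $\mathcal D(C)$ is the set of developable strips along $C$ such that $\mathbf c_f$ induces the orientation of $C$ and $0<|\cos\alpha_f|<1$; one normalizes $0<|\alpha_f|<\pi/2$ (first angular function) and $0<\beta_f<\pi$ (second angular function); vanishing Gaussian curvature is equivalent to $\cot\beta_f=(\alpha_f'+|\mathbf c_f'|\tau_f)/(|\mathbf c_f'|\kappa_f\sin\alpha_f)$. The geodesic curvature function is $\mu_f:=\kappa_f\cos\alpha_f>0$. $f$ is admissible if $\mu_f(u)<\min_w\kappa_f(w)$ for all $u$; $\mathcal D_*(C)$ is the set of admissible strips, and $\mathcal D_*(|C|):=\mathcal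 D_*(C)\cup\mathcal D_*(-C)$. Normal forms: a normal form is a developable strip $F(s,v)$ defined near $J\times\{0\}$ such that $s\mapsto F(s,0)$ is an arc-length parametrization of $C$. A normal form is determined by this parametrization and its first angular function, and every smooth function with values in $(-\pi/2,\pi/2)\setminus\{0\}$ occurs. The dual $\check F$ of a normal form $F$ is the normal form with $\check F(s,0)=F(s,0)$ and first angular function $-\alpha_F$. Curved foldings: the origami map of a normal form $F$ is $\Phi_F(s,v)=F(s,v)$ for $v\ge 0$ and $\Phi_F(s,v)=\check F(s,v)$ for $v<0$. Two functions $\mu_1,\mu_2$ on $[-l/2,l/2]$ are equi-affine equivalent if $\mu_2(\sigma s+d)=\mu_1(s)$ for some $\sigma\in\{1,-1\}$, $d\in\mathbb R$. $\Gamma$ is a generator (crease pattern) of $F$ if the curvature function of $\gamma$ is equi-affine equivalent to $\mu_F$. $\mathcal P_*(\Gamma,|C|)$ is the set of germs along $C$ of the images $\Phi_F(J\times(-\epsilon,\epsilon))$, $F$ ranging over normal forms in $\mathcal D_*(|C|)$ having generator $\Gamma$. Two such germs are congruent if there exist an isometry $T$ of $\mathbb R^3$ and $\epsilon_0>0$ such that $T$ maps the first image onto the second for all $0<\epsilon<\epsilon_0$. Symmetry: a subset $A\subset\mathbb R^k$ ($k=2,3$) has a symmetry $T$ if $T(A)=A$ for an isometry $T$ of $\mathbb R^k$ other than the identity; the symmetry is non-trivial if $T(\mathbf x)\ne\mathbf x$ for some $\mathbf x\in A$, and positive (resp. negative) if $T$ preserves (resp. reverses) orientation of $\mathbb R^k$.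 *)

(* Defs.v *)
From Stdlib Require Import Reals Lra.
From Coquelicot Require Import Coquelicot.
Open Scope R_scope.

Record V3 := mk3 { v1 : R; v2 : R; v3 : R }.
Record V2 := mk2 { w1 : R; w2 : R }.

Definition add3 (u v : V3) : V3 := mk3 (v1 u + v1 v) (v2 u + v2 v) (v3 u + v3 v).
Definition sub3 (u v : V3) : V3 := mk3 (v1 u - v1 v) (v2 u - v2 v) (v3 u - v3 v).
Definition scal3 (a : R) (u : V3) : V3 := mk3 (a * v1 u) (a * v2 u) (a * v3 u).
Definition dot3 (u v : V3) : R := v1 u * v1 v + v2 u * v2 v + v3 u * v3 v.
Definition cross3 (u v : V3) : V3 :=
  mk3 (v2 u * v3 v - v3 u * v2 v) (v3 u * v1 v - v1 u * v3 v) (v1 u * v2 v - v2 u * v1 v).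
Definition norm3 (u : V3) : R := sqrt (dot3 u u).
Definition det3 (u v w : V3) : R := dot3 u (cross3 v w).
Definition dist3 (u v : V3) : R := norm3 (sub3 u v).

Definition sub2 (u v : V2) : V2 := mk2 (w1 u - w1 v) (w2 u - w2 v).
Definition dot2 (u v : V2) : R := w1 u * w1 v + w2 u * w2 v.
Definition norm2 (u : V2) : R := sqrt (dot2 u u).
Definition det2 (u v : V2) : R := w1 u * w2 v - w2 u * w1 v.
Definition dist2 (u v : V2) : R := norm2 (sub2 u v).

Definition smooth (f : R -> R) : Prop := forall (n : nat) (x : R), ex_derive_n f n x.
Definition smooth3 (c : R -> V3) : Prop :=
  smooth (fun t => v1 (c t)) /\ smooth (fun t => v2 (c t)) /\ smooth (fun t => v3 (c t)).
Definition smooth2 (g : R -> V2) : Prop :=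
  smooth (fun t => w1 (g t)) /\ smooth (fun t => w2 (g t)).

Definition D3 (c : R -> V3) : R -> V3 := fun s =>
  mk3 (Derive (fun t => v1 (c t)) s) (Derive (fun t => v2 (c t)) s) (Derive (fun t => v3 (c t)) s).
Definition D2 (g : R -> V2) : R -> V2 := fun s =>
  mk2 (Derive (fun t => w1 (g t)) s) (Derive (fun t => w2 (g t)) s).

Definition inJ (l s : R) : Prop := - (l / 2) <= s <= l / 2.

Definition curv (c : R -> V3) (s : R) : R :=
  norm3 (cross3 (D3 c s) (D3 (D3 c) s)) / (norm3 (D3 c s)) ^ 3.
Definition tors (c : R -> V3) (s : R) : R :=
  det3 (D3 c s) (D3 (D3 c) s) (D3 (D3 (D3 c)) s)
  / (norm3 (cross3 (D3 c s) (D3 (D3 c) s))) ^ 2.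
Definition tang (c : R -> V3) (s : R) : V3 := scal3 (/ norm3 (D3 c s)) (D3 c s).
Definition binorm (c : R -> V3) (s : R) : V3 :=
  scal3 (/ norm3 (cross3 (D3 c s) (D3 (D3 c) s))) (cross3 (D3 c s) (D3 (D3 c) s)).
Definition prnorm (c : R -> V3) (s : R) : V3 := cross3 (binorm c s) (tang c s).

Definition curv2 (g : R -> V2) (s : R) : R :=
  Rabs (det2 (D2 g s) (D2 (D2 g) s)) / (norm2 (D2 g s)) ^ 3.

(** * Normal forms: base arc-length parametrization cf and first angular function a *)
(** second angular function beta in (0,pi), from cot beta = (a' + |c'| tau)/(|c'| kappa sin a) *)
Definition beta (cf : R -> V3) (a : R -> R) (s : R) : R :=
  PI / 2 - atan ((Derive a s + norm3 (D3 cf s) * tors cf s)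
                 / (norm3 (D3 cf s) * curv cf s * sin (a s))).
Definition ruling (cf : R -> V3) (a : R -> R) (s : R) : V3 :=
  add3 (scal3 (cos (beta cf a s)) (tang cf s))
       (scal3 (sin (beta cf a s))
              (add3 (scal3 (cos (a s)) (prnorm cf s)) (scal3 (sin (a s)) (binorm cf s)))).
Definition strip (cf : R -> V3) (a : R -> R) (s v : R) : V3 :=
  add3 (cf s) (scal3 v (ruling cf a s)).

Definition origami (cf : R -> V3) (a : R -> R) (s v : R) : V3 :=
  if Rle_dec 0 v then strip cf a s v else strip cf (fun t => - a t) s v.

Definition mu (cf : R -> V3) (a : R -> R) (s : R) : R := curv cf s * cos (a s).

Definition equi_affine (l : R) (m1 m2 : R -> R) : Prop :=
  exists sg d : R, (sg = 1 \/ sg = -1) /\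
    forall s, inJ l s -> inJ l (sg * s + d) /\ m2 (sg * s + d) = m1 s.

(** A normal form F = (cf, a) belonging to D_*(|C|) with generator Gamma = gamma(J).
    cf : an arc-length parametrization of C (either orientation) on J. *)
Definition inP (l : R) (C : V3 -> Prop) (gamma : R -> V2) (F : (R -> V3) * (R -> R)) : Prop :=
  let cf := fst F in let a := snd F in
  smooth3 cf /\ (forall s, inJ l s -> norm3 (D3 cf s) = 1)
  /\ (forall s t, inJ l s -> inJ l t -> cf s = cf t -> s = t)
  /\ (forall x, C x <-> exists s, inJ l s /\ cf s = x)
  /\ smooth a
  /\ (forall s, inJ l s -> - (PI / 2) < a s < PI / 2 /\ a s <> 0)
  /\ (forall s w, inJ l s -> inJ l w -> mu cf a s < curv cf w)        (* admissible *)
  /\ equi_affine l (curv2 gamma) (mu cf a).                           (* generator *)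

Definition img (l : R) (F : (R -> V3) * (R -> R)) (eps : R) (x : V3) : Prop :=
  exists s v, inJ l s /\ - eps < v < eps /\ x = origami (fst F) (snd F) s v.

Definition isometry3 (T : V3 -> V3) : Prop := forall x y, dist3 (T x) (T y) = dist3 x y.
Definition isometry2 (T : V2 -> V2) : Prop := forall x y, dist2 (T x) (T y) = dist2 x y.

Definition congruent (l : R) (F1 F2 : (R -> V3) * (R -> R)) : Prop :=
  exists T, isometry3 T /\ exists eps0, 0 < eps0 /\
    forall eps, 0 < eps < eps0 ->
      forall y, img l F2 eps y <-> exists x, img l F1 eps x /\ T x = y.

Definition num_classes {X : Type} (P : X -> Prop) (cong : X -> X -> Prop) (k : nat) : Prop :=
  exists reps : nat -> X,
    (forall i, (i < k)%nat -> P (reps i)) /\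
    (forall i j, (i < k)%nat -> (j < k)%nat -> i <> j -> ~ cong (reps i) (reps j)) /\
    (forall x, P x -> exists i, (i < k)%nat /\ cong x (reps i)).

Definition symmetry3 (A : V3 -> Prop) (T : V3 -> V3) : Prop :=
  isometry3 T /\ (exists x, T x <> x) /\ (forall y, A y <-> exists x, A x /\ T x = y).
Definition symmetry2 (A : V2 -> Prop) (T : V2 -> V2) : Prop :=
  isometry2 T /\ (exists x, T x <> x) /\ (forall y, A y <-> exists x, A x /\ T x = y).
Definition has_sym3 (A : V3 -> Prop) : Prop := exists T, symmetry3 A T.
Definition has_sym2 (A : V2 -> Prop) : Prop := exists T, symmetry2 A T.
Definition has_nontriv_sym3 (A : V3 -> Prop) : Prop :=
  exists T, symmetry3 A T /\ exists x, A x /\ T x <> x.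
Definition orient_pres3 (T : V3 -> V3) : Prop :=
  forall x0 x1 x2 x3,
    det3 (sub3 (T x1) (T x0)) (sub3 (T x2) (T x0)) (sub3 (T x3) (T x0))
    = det3 (sub3 x1 x0) (sub3 x2 x0) (sub3 x3 x0).
Definition has_pos_sym3 (A : V3 -> Prop) : Prop := exists T, symmetry3 A T /\ orient_pres3 T.

Definition planar (A : V3 -> Prop) : Prop :=
  exists (nv : V3) (d : R), nv <> mk3 0 0 0 /\ forall x, A x -> dot3 nv x = d.

(* Main.v *)
(* Modulo the tangent line, the folded paper along a crease [c] with first angular function [a] has
   at [c s] exactly two rays, at the angles [a s] and [PI - a s] of the normal plane. The images for
   small widths therefore determine [a], and they shrink to the crease, so every congruence is an
   isometry [T] with [T (c s) = c (rho * s)], [rho = 1] or [-1]: two unit-speed parametrizations of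
   an embedded arc agree up to reversal. Such a [T] of determinant [d] turns [a] into
   [rho * d * a (rho * s)]. Reversing the parameter identifies the eight normal forms in pairs, which
   leaves the four angular functions [A1], [- A1], [A2], [- A2] on [c], where [curv c * cos A1] is
   the curvature of [gamma] and [curv c * cos A2] that of the reversed [gamma]. The classes are the
   orbits of these four under the pairs [(rho, d)] realized by [C]: [(1, -1)] occurs exactly when [C]
   is planar, [(-1, d)] makes the curvature of [c] even and so [A2 s = A1 (- s)], and [A1 = A2]
   exactly when [gamma] has an even curvature, i.e. when [Gam] has a symmetry. *)

Require Import Defs.
From Stdlib Require Import Reals Lra Lia Psatz Classical ClassicalEpsilon FunctionalExtensionality.
From Coquelicot Require Import Coquelicot.
Open Scope R_scope.

(** * Isometries of space *)


(** All data are functions on the whole line, while unit speed, injectivity and curvature are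
    controlled only on [J]. Hence the comparison of derivatives up to the end points of [J], and the
    cut-off function needed to make angular functions smooth on all of [R]. Congruence is an
    equality of point sets and comes without a matching of the parameters [(s, v)]: a point of one
    folding may lie in the other on a ruling issued from a nearby crease point. A bi-Lipschitz bound
    for the crease makes the shift in [s] at most proportional to [v], so it displaces the crease in
    normal directions by [O(v^2)] only, and rays at one point can be compared to first order. The
    second ray has angle [PI - a s] because negative [v] runs backwards along the dual ruling; as
    [|a s| < PI / 2], the principal normal tells the two rays apart. Non-emptiness of the family
    gives [0 < curv2 gamma s < curv c r] for all [s], [r] in [J]. This makes all four normal forms
    admissible and keeps the signed curvature of [gamma] from vanishing, so that its absolute value
    agrees on [J] with a smooth function and [gamma] lies on no line. *)

Lemma V3_ext (x y : V3) : v1 x = v1 y -> v2 x = v2 y -> v3 x = v3 y -> x = y.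
Proof. destruct x, y; simpl; intros; subst; reflexivity. Qed.

Lemma V2_ext (x y : V2) : w1 x = w1 y -> w2 x = w2 y -> x = y.
Proof. destruct x, y; simpl; intros; subst; reflexivity. Qed.

Ltac unfold3 :=
  unfold det3, add3, sub3, scal3, cross3, dot3 in *; cbn [v1 v2 v3] in *.
Ltac vring := try (apply V3_ext); unfold3; ring.

Definition zero3 : V3 := mk3 0 0 0.

Lemma dot3_pos (x : V3) : 0 <= dot3 x x.
Proof. unfold dot3; nra. Qed.

Lemma dot3_eq0 (x : V3) : dot3 x x = 0 -> x = zero3.
Proof. unfold dot3; intros H; apply V3_ext; simpl; nra. Qed.

Lemma norm3_pos (x : V3) : 0 <= norm3 x.
Proof. apply sqrt_pos. Qed.

Lemma norm3_sqr (x : V3) : norm3 x * norm3 x = dot3 x x.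
Proof. apply sqrt_sqrt, dot3_pos. Qed.

Lemma norm3_eq0 (x : V3) : norm3 x = 0 -> x = zero3.
Proof. intros H; apply dot3_eq0; rewrite <- norm3_sqr, H; ring. Qed.

Lemma norm3_1 (x : V3) : norm3 x = 1 -> dot3 x x = 1.
Proof. intros H; rewrite <- norm3_sqr, H; ring. Qed.


Lemma dot3_CS (x y : V3) : Rabs (dot3 x y) <= norm3 x * norm3 y.
Proof.
  pose proof (norm3_pos x); pose proof (norm3_pos y).
  rewrite <- (Rabs_pos_eq (norm3 x * norm3 y)) by nra.
  apply Rsqr_le_abs_0; unfold Rsqr.
  replace (norm3 x * norm3 y * (norm3 x * norm3 y))
    with (norm3 x * norm3 x * (norm3 y * norm3 y)) by ring.
  rewrite !norm3_sqr.
  (* Lagrange's identity: the squared norm of the cross product is the defect in the Cauchy-Schwarz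
     inequality. *)
  pose proof (dot3_pos (cross3 x y)) as Hc.
  replace (dot3 (cross3 x y) (cross3 x y))
    with (dot3 x x * dot3 y y - dot3 x y * dot3 x y) in Hc by vring.
  lra.
Qed.

Lemma norm3_triang (x y : V3) : norm3 (add3 x y) <= norm3 x + norm3 y.
Proof.
  pose proof (norm3_pos x); pose proof (norm3_pos y).
  apply Rsqr_incr_0_var; [| lra]; unfold Rsqr.
  rewrite norm3_sqr.
  replace (dot3 (add3 x y) (add3 x y)) with (dot3 x x + dot3 y y + 2 * dot3 x y) by vring.
  rewrite <- !norm3_sqr.
  pose proof (dot3_CS x y); pose proof (Rle_abs (dot3 x y)); lra.
Qed.

Lemma norm3_scal (a : R) (x : V3) : norm3 (scal3 a x) = Rabs a * norm3 x.
Proof.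
  unfold norm3.
  replace (dot3 (scal3 a x) (scal3 a x)) with (Rsqr a * dot3 x x) by (unfold Rsqr; vring).
  rewrite sqrt_mult; [| apply Rle_0_sqr | apply dot3_pos].
  now rewrite sqrt_Rsqr_abs.
Qed.

Lemma dist3_eq0 (x y : V3) : dist3 x y = 0 -> x = y.
Proof.
  intros H; apply norm3_eq0 in H.
  apply V3_ext; [apply (f_equal v1) in H | apply (f_equal v2) in H | apply (f_equal v3) in H];
    simpl in H; lra.
Qed.

Definition lin3 (u v w x : V3) : V3 :=
  add3 (add3 (scal3 (v1 x) u) (scal3 (v2 x) v)) (scal3 (v3 x) w).

Definition orthonormal (u v w : V3) : Prop :=
  dot3 u u = 1 /\ dot3 v v = 1 /\ dot3 w w = 1 /\
  dot3 u v = 0 /\ dot3 v w = 0 /\ dot3 u w = 0.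

Lemma orthonormal_cross (u v w : V3) : orthonormal u v w ->
  exists d, (d = 1 \/ d = -1) /\ cross3 u v = scal3 d w /\ cross3 v w = scal3 d u /\
    cross3 w u = scal3 d v.
Proof.
  intros (Hu & Hv & Hw & Huv & Hvw & Huw).
  set (d := det3 u v w).
  assert (Hd : d * d = 1).
  (* The square of the determinant is the Gram determinant. *)
  { assert (E : d * d = dot3 u u * (dot3 v v * dot3 w w - dot3 v w * dot3 v w)
              - dot3 u v * (dot3 u v * dot3 w w - dot3 v w * dot3 u w)
              + dot3 u w * (dot3 u v * dot3 v w - dot3 v v * dot3 u w))
      by (unfold d; vring).
    rewrite E, Hu, Hv, Hw, Huv, Hvw, Huw; ring. }
  assert (G : forall x y z, dot3 x x = 1 -> dot3 y y = 1 -> dot3 z z = 1 -> dot3 x y = 0 ->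
     det3 x y z = d -> cross3 x y = scal3 d z).
  { intros x y z Hx Hy Hz Hxy E.
    (* The squared norm of the difference expands to [1 - 2 * d * d + d * d]. *)
    assert (Z : sub3 (cross3 x y) (scal3 d z) = zero3).
    { apply dot3_eq0.
      transitivity (dot3 x x * dot3 y y - dot3 x y * dot3 x y - 2 * d * det3 x y z
         + d * d * dot3 z z); [vring|].
      rewrite Hx, Hy, Hz, Hxy, E; nra. }
    apply V3_ext; [apply (f_equal v1) in Z | apply (f_equal v2) in Z | apply (f_equal v3) in Z];
      unfold zero3 in Z; unfold3; lra. }
  exists d; repeat split.
  - assert (K : (d - 1) * (d + 1) = 0) by nra.
    apply Rmult_integral in K; destruct K; [left | right]; lra.
  - apply G; auto.
  - apply G; auto; unfold d; vring.
  - apply G; auto; [rewrite <- Huw | unfold d]; vring.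
Qed.

(** After subtracting the image of the origin, polarization shows that dot products are preserved.
    Linearity follows at once: the squared distance from [L x] to the combination of the images of
    the basis involves only preserved dot products, and it vanishes for the identity. *)
Lemma isometry3_lin (T : V3 -> V3) : isometry3 T ->
  exists t u v w, orthonormal u v w /\ forall x, T x = add3 (lin3 u v w x) t.
Proof.
  intros HT.
  set (t := T zero3); set (L x := sub3 (T x) t).
  assert (Hsub : forall x y, dot3 (sub3 (L x) (L y)) (sub3 (L x) (L y)) = dot3 (sub3 x y) (sub3 x y)).
  { intros x y. specialize (HT x y). unfold dist3 in HT.
    rewrite <- (norm3_sqr (sub3 x y)), <- HT, norm3_sqr. unfold L. vring. }
  assert (Hn : forall x, dot3 (L x) (L x) = dot3 x x).
  { intros x. specialize (Hsub x zero3).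
    replace (dot3 (sub3 x zero3) (sub3 x zero3)) with (dot3 x x) in Hsub by (unfold zero3; vring).
    rewrite <- Hsub. unfold L, t. vring. }
  assert (Hd : forall x y, dot3 (L x) (L y) = dot3 x y).
  { intros x y.
    pose proof (Hsub x y) as H; pose proof (Hn x); pose proof (Hn y).
    replace (dot3 (sub3 (L x) (L y)) (sub3 (L x) (L y)))
      with (dot3 (L x) (L x) + dot3 (L y) (L y) - 2 * dot3 (L x) (L y)) in H by vring.
    replace (dot3 (sub3 x y) (sub3 x y)) with (dot3 x x + dot3 y y - 2 * dot3 x y) in H by vring.
    lra. }
  set (e1 := mk3 1 0 0); set (e2 := mk3 0 1 0); set (e3 := mk3 0 0 1).
  exists t, (L e1), (L e2), (L e3); split.
  - unfold orthonormal; rewrite !Hd; unfold e1, e2, e3; unfold3; repeat split; ring.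
  - intros x.
    assert (Z : sub3 (L x) (lin3 (L e1) (L e2) (L e3) x) = zero3).
    { apply dot3_eq0.
      transitivity (dot3 (L x) (L x)
        + v1 x * v1 x * dot3 (L e1) (L e1) + v2 x * v2 x * dot3 (L e2) (L e2)
        + v3 x * v3 x * dot3 (L e3) (L e3)
        - 2 * v1 x * dot3 (L x) (L e1) - 2 * v2 x * dot3 (L x) (L e2) - 2 * v3 x * dot3 (L x) (L e3)
        + 2 * v1 x * v2 x * dot3 (L e1) (L e2) + 2 * v1 x * v3 x * dot3 (L e1) (L e3)
        + 2 * v2 x * v3 x * dot3 (L e2) (L e3)).
      - generalize (L x) (L e1) (L e2) (L e3); intros; unfold lin3; vring.
      - rewrite !Hd; unfold e1, e2, e3; unfold3; ring. }
    assert (E : T x = add3 (L x) t) by (unfold L; vring).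
    rewrite E.
    apply V3_ext; [apply (f_equal v1) in Z | apply (f_equal v2) in Z | apply (f_equal v3) in Z];
      unfold zero3 in Z; unfold3; lra.
Qed.

(* [u], [v], [w] are the columns of the linear part, [d] its determinant. *)
Definition motion (T : V3 -> V3) (u v w t : V3) (d : R) : Prop :=
  orthonormal u v w /\ (d = 1 \/ d = -1) /\
  cross3 u v = scal3 d w /\ cross3 v w = scal3 d u /\ cross3 w u = scal3 d v /\
  forall x, T x = add3 (lin3 u v w x) t.

Lemma isometry3_motion (T : V3 -> V3) : isometry3 T -> exists u v w t d, motion T u v w t d.
Proof.
  intros HT; destruct (isometry3_lin T HT) as (t & u & v & w & Ho & E).
  destruct (orthonormal_cross u v w Ho) as (d & Hd & H1 & H2 & H3).
  exists u, v, w, t, d; unfold motion; tauto.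
Qed.

Lemma lin3_dot (u v w x y : V3) : orthonormal u v w ->
  dot3 (lin3 u v w x) (lin3 u v w y) = dot3 x y.
Proof.
  intros (Hu & Hv & Hw & Huv & Hvw & Huw).
  transitivity (v1 x * v1 y * dot3 u u + v2 x * v2 y * dot3 v v + v3 x * v3 y * dot3 w w
    + (v1 x * v2 y + v2 x * v1 y) * dot3 u v + (v2 x * v3 y + v3 x * v2 y) * dot3 v w
    + (v1 x * v3 y + v3 x * v1 y) * dot3 u w); [unfold lin3; vring|].
  rewrite Hu, Hv, Hw, Huv, Hvw, Huw; unfold dot3; ring.
Qed.

Lemma lin3_norm (u v w x : V3) : orthonormal u v w -> norm3 (lin3 u v w x) = norm3 x.
Proof. intros H; unfold norm3; now rewrite lin3_dot. Qed.

Lemma lin3_cross (u v w : V3) (d : R) (x y : V3) :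
  cross3 u v = scal3 d w -> cross3 v w = scal3 d u -> cross3 w u = scal3 d v ->
  cross3 (lin3 u v w x) (lin3 u v w y) = scal3 d (lin3 u v w (cross3 x y)).
Proof.
  intros H1 H2 H3.
  transitivity (add3 (add3 (scal3 (v3 (cross3 x y)) (cross3 u v))
     (scal3 (v1 (cross3 x y)) (cross3 v w))) (scal3 (v2 (cross3 x y)) (cross3 w u)));
    [unfold lin3; vring|].
  rewrite H1, H2, H3; unfold lin3; vring.
Qed.

Lemma lin3_det (u v w : V3) (d : R) (x y z : V3) : orthonormal u v w ->
  cross3 u v = scal3 d w -> cross3 v w = scal3 d u -> cross3 w u = scal3 d v ->
  det3 (lin3 u v w x) (lin3 u v w y) (lin3 u v w z) = d * det3 x y z.
Proof.
  intros Ho H1 H2 H3; unfold det3; rewrite (lin3_cross u v w d y z) by assumption.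
  replace (dot3 (lin3 u v w x) (scal3 d (lin3 u v w (cross3 y z))))
    with (d * dot3 (lin3 u v w x) (lin3 u v w (cross3 y z))) by vring.
  now rewrite lin3_dot.
Qed.

Lemma lin3_isometry (u v w t : V3) : orthonormal u v w ->
  isometry3 (fun x => add3 (lin3 u v w x) t).
Proof.
  intros Ho x y; unfold dist3.
  replace (sub3 (add3 (lin3 u v w x) t) (add3 (lin3 u v w y) t))
    with (lin3 u v w (sub3 x y)) by (unfold lin3; vring).
  now apply lin3_norm.
Qed.

Lemma isometry3_comp (S T : V3 -> V3) : isometry3 S -> isometry3 T ->
  isometry3 (fun x => S (T x)).
Proof. intros HS HT x y; now rewrite HS, HT. Qed.

Lemma isometry3_inj (T : V3 -> V3) (x y : V3) : isometry3 T -> T x = T y -> x = y.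
Proof.
  intros HT E; apply dist3_eq0; rewrite <- HT, E.
  unfold dist3, norm3. replace (dot3 _ _) with 0 by vring. apply sqrt_0.
Qed.

(** The linear part of the inverse is the transpose. That it is also a right inverse is the
    completeness of the columns, i.e. Parseval's identity [Hz]. *)
Lemma isometry3_inverse (T : V3 -> V3) : isometry3 T ->
  exists S, isometry3 S /\ (forall x, S (T x) = x) /\ (forall x, T (S x) = x).
Proof.
  intros HT; destruct (isometry3_motion T HT) as (u & v & w & t & d & Ho & Hd & H1 & H2 & H3 & E).
  set (S y := let z := sub3 y t in mk3 (dot3 u z) (dot3 v z) (dot3 w z)).
  assert (HST : forall x, S (T x) = x).
  { intros x; unfold S; rewrite E; destruct Ho as (Hu & Hv & Hw & Huv & Hvw & Huw).
    apply V3_ext; cbn [v1 v2 v3]; unfold lin3.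
    - transitivity (v1 x * dot3 u u + v2 x * dot3 u v + v3 x * dot3 u w); [vring|].
      rewrite Hu, Huv, Huw; ring.
    - transitivity (v1 x * dot3 u v + v2 x * dot3 v v + v3 x * dot3 v w); [vring|].
      rewrite Hv, Huv, Hvw; ring.
    - transitivity (v1 x * dot3 u w + v2 x * dot3 v w + v3 x * dot3 w w); [vring|].
      rewrite Hw, Huw, Hvw; ring. }
  assert (HTS : forall x, T (S x) = x).
  { intros y; rewrite E.
    set (z := sub3 y t).
    assert (Z : sub3 (lin3 u v w (S y)) z = zero3).
    { apply dot3_eq0.
      replace (dot3 (sub3 (lin3 u v w (S y)) z) (sub3 (lin3 u v w (S y)) z))
        with (dot3 (lin3 u v w (S y)) (lin3 u v w (S y)) - 2 * dot3 (lin3 u v w (S y)) z + dot3 z z)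
        by vring.
      rewrite lin3_dot by assumption.
      assert (Hz : dot3 u z * dot3 u z + dot3 v z * dot3 v z + dot3 w z * dot3 w z = dot3 z z).
      { assert (Hdd : d * d = 1) by (destruct Hd; subst; ring).
        assert (Hdet : det3 u v w = d).
        { unfold det3; rewrite H2. destruct Ho as (Hu & _).
          transitivity (d * dot3 u u); [vring | rewrite Hu; ring]. }
        (* Cramer's identity; for an orthonormal frame the cross products are the frame vectors up
           to the factor [d]. *)
        assert (C : scal3 (det3 u v w) z
           = add3 (add3 (scal3 (dot3 u z) (cross3 v w)) (scal3 (dot3 v z) (cross3 w u)))
               (scal3 (dot3 w z) (cross3 u v))) by vring.
        rewrite H1, H2, H3, Hdet in C.
        apply (f_equal (fun q => dot3 (scal3 d q) z)) in C.
        transitivity (d * d * (dot3 u z * dot3 u z + dot3 v z * dot3 v z + dot3 w z * dot3 w z));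
          [rewrite Hdd; ring|].
        transitivity (d * d * dot3 z z); [| rewrite Hdd; ring].
        transitivity (dot3 (scal3 d (scal3 d z)) z); [rewrite C |]; vring. }
      transitivity (dot3 z z - (dot3 u z * dot3 u z + dot3 v z * dot3 v z + dot3 w z * dot3 w z));
       [| rewrite Hz; ring].
      unfold S; fold z; unfold lin3; cbn [v1 v2 v3].
      vring. }
    unfold z in Z.
    apply V3_ext; [apply (f_equal v1) in Z | apply (f_equal v2) in Z | apply (f_equal v3) in Z];
      unfold zero3 in Z; cbn [v1 v2 v3 sub3 add3] in *; lra. }
  exists S; repeat split; auto.
  intros x y; rewrite <- (HTS x) at 2; rewrite <- (HTS y) at 2; now rewrite HT.
Qed.

(* A point fixed by [T] is equidistant from [x] and [T x]. *)
Lemma isometry3_fixed_planar (T : V3 -> V3) (A : V3 -> Prop) : isometry3 T ->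
  (exists x, T x <> x) -> (forall y, A y -> T y = y) -> planar A.
Proof.
  intros HT [x Hx] HA.
  exists (sub3 (T x) x), ((dot3 (T x) (T x) - dot3 x x) / 2); split.
  - intros H; apply Hx.
    apply V3_ext; [apply (f_equal v1) in H | apply (f_equal v2) in H | apply (f_equal v3) in H];
      cbn in H; lra.
  - intros y Hy.
    assert (E : dot3 (sub3 (T x) y) (sub3 (T x) y) = dot3 (sub3 x y) (sub3 x y)).
    { rewrite <- !norm3_sqr. fold (dist3 (T x) y) (dist3 x y).
      rewrite <- (HA y Hy) at 1 2. now rewrite HT. }
    unfold3; lra.
Qed.

(** * Reflections in planes *)

Definition reflection (n : V3) (e : R) (x : V3) : V3 :=
  sub3 x (scal3 (2 * (dot3 n x - e) / dot3 n n) n).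

Lemma reflection_sub (n : V3) (e : R) (x y : V3) : n <> zero3 ->
  sub3 (reflection n e x) (reflection n e y)
  = sub3 (sub3 x y) (scal3 (2 * (dot3 n (sub3 x y) / dot3 n n)) n).
Proof.
  intros Hn; assert (Hnn : dot3 n n <> 0) by (intros H; apply Hn, dot3_eq0, H).
  unfold reflection.
  replace (2 * (dot3 n (sub3 x y) / dot3 n n))
    with (2 * (dot3 n x - e) / dot3 n n - 2 * (dot3 n y - e) / dot3 n n)
    by (replace (dot3 n (sub3 x y)) with (dot3 n x - dot3 n y) by vring; field; auto).
  generalize (2 * (dot3 n x - e) / dot3 n n) (2 * (dot3 n y - e) / dot3 n n); intros; vring.
Qed.

Lemma reflection_isometry (n : V3) (e : R) : n <> zero3 -> isometry3 (reflection n e).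
Proof.
  intros Hn x y; unfold dist3, norm3; f_equal.
  assert (Hnn : dot3 n n <> 0) by (intros H; apply Hn, dot3_eq0, H).
  rewrite reflection_sub by auto.
  set (k := dot3 n (sub3 x y) / dot3 n n).
  assert (Hk : k * dot3 n n = dot3 n (sub3 x y)) by (unfold k; field; auto).
  transitivity (dot3 (sub3 x y) (sub3 x y) - 4 * k * (dot3 n (sub3 x y) - k * dot3 n n)); [vring|].
  rewrite Hk; ring.
Qed.

Lemma reflection_det (n : V3) (e : R) : n <> zero3 -> forall x0 x1 x2 x3,
  det3 (sub3 (reflection n e x1) (reflection n e x0)) (sub3 (reflection n e x2) (reflection n e x0))
    (sub3 (reflection n e x3) (reflection n e x0))
  = - det3 (sub3 x1 x0) (sub3 x2 x0) (sub3 x3 x0).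
Proof.
  intros Hn x0 x1 x2 x3.
  assert (Hnn : dot3 n n <> 0) by (intros H; apply Hn, dot3_eq0, H).
  rewrite !reflection_sub by auto.
  generalize (sub3 x1 x0) (sub3 x2 x0) (sub3 x3 x0); intros x y z.
  set (N := dot3 n n) in *.
  (* The linear part is a rank-one perturbation of the identity: in the multilinear expansion every
     determinant containing [n] twice vanishes. By Cramer's identity the remaining bracket is
     [N * det3 x y z]. *)
  transitivity (det3 x y z - 2 / N * (dot3 n x * det3 n y z + dot3 n y * det3 x n z
     + dot3 n z * det3 x y n)).
  - unfold Rdiv. generalize (/ N); intros i. vring.
  - replace (dot3 n x * det3 n y z + dot3 n y * det3 x n z + dot3 n z * det3 x y n)
      with (N * det3 x y z) by (unfold N; vring).
    field; auto.
Qed.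

Lemma reflection_fix (n : V3) (e : R) (x : V3) : dot3 n x = e -> reflection n e x = x.
Proof. intros E; unfold reflection; rewrite E. unfold Rdiv. vring. Qed.

(** * Smooth functions *)


(** [Derive_n] adds new derivatives on the outside; recursing through [Derive f] instead turns the
    product and chain rules into inductions on [n]. *)
Fixpoint Cn (n : nat) (f : R -> R) : Prop :=
  match n with
  | O => True
  | S m => (forall x, ex_derive f x) /\ Cn m (Derive f)
  end.

Lemma Derive_n_Derive (f : R -> R) (n : nat) : Derive_n (Derive f) n = Derive_n f (S n).
Proof.
  apply functional_extensionality; intros x.
  change (Derive f) with (Derive_n f 1); rewrite Derive_n_comp; f_equal; lia.
Qed.

Lemma smooth_Cn (f : R -> R) : smooth f <-> forall n, Cn n f.
Proof.
  split.
  - intros H n; revert f H; induction n as [|n IH]; intros f H; simpl; auto.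
    split; [exact (H 1%nat)|].
    apply IH; intros [|m] x; simpl; auto.
    rewrite Derive_n_Derive; exact (H (S (S m)) x).
  - intros H [|n]; [intros x; exact I|].
    revert f H; induction n as [|n IH]; intros f H x.
    + exact (proj1 (H 1%nat) x).
    + assert (H' : forall n, Cn n (Derive f)) by (intros m; exact (proj2 (H (S m)))).
      specialize (IH _ H' x); simpl in IH |- *; now rewrite Derive_n_Derive in IH.
Qed.

Lemma smooth_ex_derive (f : R -> R) (x : R) : smooth f -> ex_derive f x.
Proof. intros H; exact (H 1%nat x). Qed.

Lemma smooth_is_derive (f : R -> R) (x : R) : smooth f -> is_derive f x (Derive f x).
Proof. intros H; now apply Derive_correct, smooth_ex_derive. Qed.

Lemma smooth_Derive (f : R -> R) : smooth f -> smooth (Derive f).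
Proof. rewrite !smooth_Cn; intros H n; exact (proj2 (H (S n))). Qed.

Lemma smooth_continuous (f : R -> R) (x : R) : smooth f -> continuous f x.
Proof. intros H; now apply (ex_derive_continuous f), smooth_ex_derive. Qed.

Lemma Cn_le (n : nat) : forall f, Cn (S n) f -> Cn n f.
Proof. induction n as [|n IH]; intros f [H1 H2]; simpl; auto. Qed.

Lemma Cn_intro (n : nat) (f f' : R -> R) :
  (forall x, is_derive f x (f' x)) -> Cn n f' -> Cn (S n) f.
Proof.
  intros H H'; split; [intros x; exists (f' x); apply H|].
  replace (Derive f) with f'; auto.
  apply functional_extensionality; intros x; symmetry; apply is_derive_unique, H.
Qed.

Lemma Cn_is_derive (n : nat) (f : R -> R) (x : R) : Cn (S n) f -> is_derive f x (Derive f x).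
Proof. intros [H _]; apply Derive_correct, H. Qed.

Lemma Cn_const (n : nat) (a : R) : Cn n (fun _ => a).
Proof.
  revert a; induction n as [|n IH]; intros a; [exact I|].
  apply Cn_intro with (f' := fun _ => 0); [intros x; apply (is_derive_const a) | apply IH].
Qed.

Lemma Cn_id (n : nat) : Cn n (fun x => x).
Proof.
  destruct n; [exact I|].
  apply Cn_intro with (f' := fun _ => 1); [intros x; apply (is_derive_id x) | apply Cn_const].
Qed.

Lemma Cn_plus (n : nat) : forall f g, Cn n f -> Cn n g -> Cn n (fun x => f x + g x).
Proof.
  induction n as [|n IH]; intros f g Hf Hg; [exact I|].
  apply Cn_intro with (f' := fun x => Derive f x + Derive g x).
  - intros x; apply (is_derive_plus f g); eapply Cn_is_derive; eauto.
  - apply IH; [apply Hf | apply Hg].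
Qed.

Lemma Cn_mult (n : nat) : forall f g, Cn n f -> Cn n g -> Cn n (fun x => f x * g x).
Proof.
  induction n as [|n IH]; intros f g Hf Hg; [exact I|].
  apply Cn_intro with (f' := fun x => Derive f x * g x + f x * Derive g x).
  - intros x; pose proof (Cn_is_derive n f x Hf); pose proof (Cn_is_derive n g x Hg).
    auto_derive; [repeat split; eexists; eauto |].
    change (Derive (fun x => f x) x) with (Derive f x).
    change (Derive (fun x => g x) x) with (Derive g x); ring.
  - apply Cn_plus; apply IH; try apply Hf; try apply Hg; now apply Cn_le.
Qed.

Lemma Cn_comp (n : nat) : forall f g, Cn n f -> Cn n g -> Cn n (fun x => f (g x)).
Proof.
  induction n as [|n IH]; intros f g Hf Hg; [exact I|].
  apply Cn_intro with (f' := fun x => Derive g x * Derive f (g x)).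
  - intros x; apply (is_derive_comp f g); eapply Cn_is_derive; eauto.
  - apply Cn_mult; [apply Hg|]; apply IH; [apply Hf | now apply Cn_le].
Qed.

Lemma Cn_inv (n : nat) (f : R -> R) : (forall x, f x <> 0) -> Cn n f -> Cn n (fun x => / f x).
Proof.
  intros H0; induction n as [|n IH]; intros Hf; [exact I|].
  apply Cn_intro with (f' := fun x => (-1) * Derive f x * (/ f x * / f x)).
  - intros x; pose proof (Cn_is_derive n f x Hf).
    auto_derive; [repeat split; [eexists; eauto | auto] |].
    change (Derive (fun x => f x) x) with (Derive f x); field; auto.
  - pose proof (IH (Cn_le _ _ Hf)).
    repeat apply Cn_mult; auto; [apply Cn_const | apply Hf].
Qed.

Lemma Cn_sqrt (n : nat) (f : R -> R) : (forall x, 0 < f x) -> Cn n f -> Cn n (fun x => sqrt (f x)).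
Proof.
  intros H0; induction n as [|n IH]; intros Hf; [exact I|].
  apply Cn_intro with (f' := fun x => / 2 * Derive f x * / sqrt (f x)).
  - intros x; pose proof (Cn_is_derive n f x Hf); pose proof (H0 x).
    assert (sqrt (f x) <> 0) by (apply Rgt_not_eq, sqrt_lt_R0; auto).
    auto_derive; [repeat split; [eexists; eauto | auto] |].
    change (Derive (fun x => f x) x) with (Derive f x); field; auto.
  - pose proof (IH (Cn_le _ _ Hf)).
    repeat apply Cn_mult; [apply Cn_const | apply Hf |].
    apply Cn_inv; auto; intros x; apply Rgt_not_eq, sqrt_lt_R0; auto.
Qed.

Lemma smooth_const (a : R) : smooth (fun _ => a).
Proof. apply smooth_Cn; intros; apply Cn_const. Qed.

Lemma smooth_id : smooth (fun x => x).
Proof. apply smooth_Cn; intros; apply Cn_id. Qed.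

Lemma smooth_plus (f g : R -> R) : smooth f -> smooth g -> smooth (fun x => f x + g x).
Proof. rewrite !smooth_Cn; intros; apply Cn_plus; auto. Qed.

Lemma smooth_mult (f g : R -> R) : smooth f -> smooth g -> smooth (fun x => f x * g x).
Proof. rewrite !smooth_Cn; intros; apply Cn_mult; auto. Qed.

Lemma smooth_ext (f g : R -> R) : (forall x, f x = g x) -> smooth f -> smooth g.
Proof. intros E; replace g with f; auto; now apply functional_extensionality. Qed.

Lemma smooth_opp (f : R -> R) : smooth f -> smooth (fun x => - f x).
Proof.
  intros H; apply smooth_ext with (fun x => (-1) * f x); [intros; ring|].
  apply smooth_mult; auto using smooth_const.
Qed.

Lemma smooth_minus (f g : R -> R) : smooth f -> smooth g -> smooth (fun x => f x - g x).
Proof. intros; apply smooth_plus; auto using smooth_opp. Qed.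

Lemma smooth_comp (f g : R -> R) : smooth f -> smooth g -> smooth (fun x => f (g x)).
Proof. rewrite !smooth_Cn; intros; apply Cn_comp; auto. Qed.

Lemma smooth_inv (f : R -> R) : (forall x, f x <> 0) -> smooth f -> smooth (fun x => / f x).
Proof. rewrite !smooth_Cn; intros; apply Cn_inv; auto. Qed.

Lemma smooth_sqrt (f : R -> R) : (forall x, 0 < f x) -> smooth f -> smooth (fun x => sqrt (f x)).
Proof. rewrite !smooth_Cn; intros; apply Cn_sqrt; auto. Qed.

Lemma smooth_atan : smooth atan.
Proof.
  apply smooth_Cn; intros [|n]; [exact I|].
  apply Cn_intro with (f' := fun x => / (1 + x * x)).
  - intros x; apply is_derive_Reals.
    replace (/ (1 + x * x)) with (/ (1 + x ^ 2)) by (f_equal; ring).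
    apply derivable_pt_lim_atan.
  - apply Cn_inv; [intros x; nra|].
    apply Cn_plus; [apply Cn_const | apply Cn_mult; apply Cn_id].
Qed.

(* [flat 0] is the usual flat function; the [flat k] are closed under differentiation up to
   linear combinations. *)
Definition flat (k : nat) (x : R) : R := if Rlt_dec 0 x then (/ x) ^ k * exp (- / x) else 0.

(** Raise [z <= exp z], for [z = y / n], to the power [n]. The case [n = 0] is separate and uses the
    convention that [0 ^ 0] is 1. *)
Lemma exp_ge_pow (n : nat) (y : R) : 0 <= y -> y ^ n <= INR n ^ n * exp y.
Proof.
  intros Hy; destruct n as [|n].
  - simpl. pose proof (exp_ineq1_le y). lra.
  - assert (Hn : 0 < INR (S n)) by (apply lt_0_INR; lia).
    set (z := y / INR (S n)).
    assert (Ey : y = INR (S n) * z) by (unfold z; field; lra).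
    assert (Hz : 0 <= z) by (apply Rmult_le_pos; [auto | left; now apply Rinv_0_lt_compat]).
    assert (E : exp y = exp z ^ S n).
    { rewrite Ey; clear; generalize (S n) as m; induction m as [|m IH].
      - simpl; rewrite Rmult_0_l; apply exp_0.
      - rewrite S_INR, Rmult_plus_distr_r, Rmult_1_l, exp_plus, IH; simpl; ring. }
    rewrite E, Ey, <- Rpow_mult_distr.
    apply pow_incr; split; [apply Rmult_le_pos; lra|].
    apply Rmult_le_compat_l; [lra|]; pose proof (exp_ineq1_le z); lra.
Qed.

Lemma flat_bound (k : nat) : exists M, 0 < M /\ forall x, 0 <= flat k x <= M * (x * x).
Proof.
  exists (INR (S (S k)) ^ S (S k)); split.
  - apply pow_lt, lt_0_INR; lia.
  - intros x; unfold flat; destruct (Rlt_dec 0 x) as [Hx|Hx].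
    + pose proof (Rinv_0_lt_compat x Hx) as Hi; pose proof (exp_pos (- / x)).
      pose proof (pow_lt (/ x) k Hi).
      split; [apply Rmult_le_pos; lra|].
      (* Two powers more than [k] leave the factor [x * x]. *)
      pose proof (exp_ge_pow (S (S k)) (/ x) (Rlt_le _ _ Hi)) as B.
      set (M := INR (S (S k)) ^ S (S k)) in *.
      simpl in B.
      assert (E : exp (/ x) * exp (- / x) = 1)
        by (rewrite <- exp_plus, Rplus_opp_r; apply exp_0).
      apply Rmult_le_compat_r with (r := exp (- / x) * (x * x)) in B; [| nra].
      replace (/ x * (/ x * (/ x) ^ k) * (exp (- / x) * (x * x)))
        with ((/ x) ^ k * exp (- / x)) in B by (field; lra).
      replace (M * exp (/ x) * (exp (- / x) * (x * x)))
        with (M * (x * x) * (exp (/ x) * exp (- / x))) in B by ring.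
      rewrite E in B; lra.
    + split; [lra|].
      apply Rmult_le_pos; [apply pow_le, pos_INR | nra].
Qed.

Lemma flat_nonpos (k : nat) (x : R) : x <= 0 -> flat k x = 0.
Proof. intros H; unfold flat; destruct (Rlt_dec 0 x); auto; lra. Qed.

(** The delicate point is 0, where the quadratic bound makes the difference quotient at most
    [M * |h|]. *)
Lemma is_derive_flat (k : nat) (x : R) :
  is_derive (flat k) x (flat (S (S k)) x - INR k * flat (S k) x).
Proof.
  destruct (Rtotal_order x 0) as [Hx | [Hx | Hx]].
  - rewrite !flat_nonpos by lra.
    replace (0 - INR k * 0) with 0 by ring.
    apply is_derive_ext_loc with (fun _ => 0); [| apply (is_derive_const 0)].
    exists (mkposreal (- x) ltac:(lra)); intros y Hy.
    apply Rabs_lt_between' in Hy; simpl in Hy.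
    symmetry; apply flat_nonpos; lra.
  - subst x; rewrite !flat_nonpos by lra.
    replace (0 - INR k * 0) with 0 by ring.
    apply is_derive_Reals; intros e He.
    destruct (flat_bound k) as (M & HM & B).
    exists (mkposreal (e / M) (Rdiv_lt_0_compat _ _ He HM)); intros h Hh Hhe; simpl in Hhe.
    rewrite Rplus_0_l, (flat_nonpos k 0), !Rminus_0_r by lra.
    rewrite Rabs_div by auto.
    pose proof (Rabs_pos_lt h Hh) as Hp.
    apply Rmult_lt_reg_r with (Rabs h); auto.
    unfold Rdiv; rewrite Rmult_assoc, Rinv_l, Rmult_1_r by lra.
    specialize (B h); rewrite Rabs_pos_eq by apply B.
    apply Rle_lt_trans with (M * (h * h)); [apply B|].
    replace (h * h) with (Rabs h * Rabs h) by (rewrite <- Rabs_mult; apply Rabs_pos_eq; nra).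
    apply Rmult_lt_compat_r with (r := M) in Hhe; auto.
    replace (e / M * M) with e in Hhe by (field; lra).
    nra.
  - apply is_derive_ext_loc with (fun y => (/ y) ^ k * exp (- / y)).
    + exists (mkposreal x Hx); intros y Hy.
      apply Rabs_lt_between' in Hy; simpl in Hy.
      unfold flat; destruct (Rlt_dec 0 y); auto; lra.
    + unfold flat; destruct (Rlt_dec 0 x) as [_|n]; [|lra].
      auto_derive; [lra|].
      destruct k as [|k]; [simpl; field; lra|].
      replace (Init.Nat.pred (S k)) with k by reflexivity.
      rewrite S_INR. cbn [pow]. field. lra.
Qed.

Lemma smooth_flat (k : nat) : smooth (flat k).
Proof.
  apply smooth_Cn; intros n; revert k; induction n as [|n IH]; intros k; [exact I|].
  apply Cn_intro with (f' := fun x => flat (S (S k)) x + (- INR k) * flat (S k) x).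
  - intros x; replace (flat (S (S k)) x + - INR k * flat (S k) x)
      with (flat (S (S k)) x - INR k * flat (S k) x) by ring.
    apply is_derive_flat.
  - apply Cn_plus; auto; apply Cn_mult; auto; apply Cn_const.
Qed.

(** The even quadratic [p] is at least 1 for [|s| <= L] and at most 0 for [|s| >= r]; [chi] is the
    classical quotient of flat functions at [p] and [1 - p], whose denominator never vanishes. *)
Lemma bump (L r : R) : 0 < L < r -> exists chi, smooth chi /\ (forall s, 0 <= chi s <= 1) /\
  (forall s, - L <= s <= L -> chi s = 1) /\ (forall s, ~ (- r < s < r) -> chi s = 0).
Proof.
  intros HL.
  set (p s := (r * r - s * s) * / (r * r - L * L)).
  set (D s := flat 0 (p s) + flat 0 (1 - p s)).
  assert (Hd : 0 < r * r - L * L) by nra.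
  assert (Hnn : forall x, 0 <= flat 0 x)
    by (intros x; destruct (flat_bound 0) as (M & _ & B); apply B).
  assert (Hpos : forall x, 0 < x -> 0 < flat 0 x).
  { intros x Hx; unfold flat; destruct (Rlt_dec 0 x); [|lra].
    simpl; rewrite Rmult_1_l; apply exp_pos. }
  assert (HD : forall s, 0 < D s).
  { intros s; unfold D; destruct (Rlt_dec 0 (p s)) as [H|H].
    - pose proof (Hpos _ H); pose proof (Hnn (1 - p s)); lra.
    - pose proof (Hpos (1 - p s) ltac:(lra)); pose proof (Hnn (p s)); lra. }
  assert (Sp : smooth p).
  { apply smooth_mult; [| apply smooth_const].
    apply smooth_minus; [apply smooth_const | apply smooth_mult; apply smooth_id]. }
  exists (fun s => flat 0 (p s) * / D s); repeat split.
  - apply smooth_mult; [apply smooth_comp; auto using smooth_flat|].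
    apply smooth_inv; [intros s; specialize (HD s); lra|].
    apply smooth_plus; apply smooth_comp; auto using smooth_flat.
    apply smooth_minus; auto using smooth_const.
  - apply Rmult_le_pos; auto; left; apply Rinv_0_lt_compat, HD.
  - apply Rmult_le_reg_r with (D s); auto.
    rewrite Rmult_assoc, Rinv_l, Rmult_1_r, Rmult_1_l by (specialize (HD s); lra).
    unfold D; pose proof (Hnn (1 - p s)); lra.
  - intros s Hs.
    assert (H1 : 1 <= p s).
    { unfold p; apply Rmult_le_reg_r with (r * r - L * L); auto.
      rewrite Rmult_assoc, Rinv_l, Rmult_1_r, Rmult_1_l by lra; nra. }
    assert (E : D s = flat 0 (p s))
      by (unfold D; rewrite (flat_nonpos 0 (1 - p s)) by lra; ring).
    rewrite <- E; apply Rinv_r; specialize (HD s); lra.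
  - intros s Hs.
    rewrite flat_nonpos; [ring|].
    unfold p; apply Rmult_le_reg_r with (r * r - L * L); auto.
    rewrite Rmult_assoc, Rinv_l, Rmult_1_r, Rmult_0_l by lra.
    destruct (Rlt_dec (- r) s); [destruct (Rlt_dec s r); [tauto|]|]; nra.
Qed.

Lemma continuous_pos_near (f : R -> R) (x : R) : continuous f x -> 0 < f x ->
  exists d, 0 < d /\ forall y, Rabs (y - x) < d -> 0 < f y.
Proof.
  intros Hc Hp.
  destruct (Hc (fun z => 0 < z)) as [d Hd].
  { exists (mkposreal _ Hp); intros z Hz; apply Rabs_lt_between' in Hz; simpl in Hz; lra. }
  exists d; split; [apply d|]; intros y Hy; now apply Hd.
Qed.

(** By continuity [f] stays positive slightly beyond the interval; there it is blended with the
    constant 1. This allows square roots and inverses of functions whose sign is known only on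
    [J]. *)
Lemma smooth_pos_extension (L : R) (f : R -> R) : 0 < L -> smooth f ->
  (forall s, - L <= s <= L -> 0 < f s) ->
  exists g, smooth g /\ (forall s, 0 < g s) /\ (forall s, - L <= s <= L -> g s = f s).
Proof.
  intros HL Hf Hp.
  destruct (continuous_pos_near f L (smooth_continuous f L Hf) (Hp L ltac:(lra))) as (d1 & Hd1 & P1).
  destruct (continuous_pos_near f (- L) (smooth_continuous f (- L) Hf) (Hp (- L) ltac:(lra)))
    as (d2 & Hd2 & P2).
  set (d := Rmin d1 d2).
  assert (Hd : 0 < d) by (now apply Rmin_glb_lt).
  pose proof (Rmin_l d1 d2) as Hl1; pose proof (Rmin_r d1 d2) as Hl2; fold d in Hl1, Hl2.
  assert (P : forall s, - (L + d) < s < L + d -> 0 < f s).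
  { intros s Hs; destruct (Rle_dec s (- L)); [|destruct (Rle_dec L s)].
    - apply P2; apply Rabs_def1; lra.
    - apply P1; apply Rabs_def1; lra.
    - apply Hp; lra. }
  destruct (bump L (L + d) ltac:(lra)) as (chi & S & B & C1 & C0).
  exists (fun s => chi s * f s + (1 - chi s)); repeat split.
  - apply smooth_plus; [now apply smooth_mult | apply smooth_minus; auto using smooth_const].
  - intros s; specialize (B s).
    destruct (classic (- (L + d) < s < L + d)) as [H|H].
    + specialize (P s H).
      destruct (Req_dec (chi s) 0) as [E|E]; [rewrite E; lra|].
      assert (0 < chi s) by lra; nra.
    + rewrite (C0 s H); lra.
  - intros s Hs; rewrite (C1 s Hs); ring.
Qed.

(** * Unit-speed curves *)


(** At an end point of [J] the functions agree on one side only, but both derivatives exist, so the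
    increments pointing into [J] already determine them. *)
Lemma Derive_eq_on (l : R) (f g : R -> R) (s : R) : 0 < l -> ex_derive f s -> ex_derive g s ->
  (forall t, inJ l t -> f t = g t) -> inJ l s -> Derive f s = Derive g s.
Proof.
  intros Hl Hf Hg E Hs.
  apply Rminus_diag_uniq; set (d := Derive f s - Derive g s).
  assert (Hd : is_derive (fun t => f t - g t) s d)
    by (apply (is_derive_minus f g); now apply Derive_correct).
  apply NNPP; intros Hn.
  apply is_derive_Reals in Hd.
  destruct (Hd (Rabs d) (Rabs_pos_lt _ Hn)) as [e He].
  pose proof (cond_pos e) as Hpe.
  set (h := Rmin (e / 2) (l / 2)).
  assert (Hh : 0 < h) by (apply Rmin_glb_lt; lra).
  assert (h <= e / 2) by apply Rmin_l; assert (h <= l / 2) by apply Rmin_r.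
  (* The increment has to point towards the middle of [J]. *)
  assert (exists h', h' <> 0 /\ Rabs h' < e /\ inJ l (s + h')) as (h' & Hh' & Hle & Hin).
  { unfold inJ in *; destruct (Rle_dec s 0).
    - exists h; rewrite Rabs_pos_eq by lra; repeat split; lra.
    - exists (- h); rewrite Rabs_Ropp, Rabs_pos_eq by lra; repeat split; lra. }
  specialize (He h' Hh' Hle).
  rewrite (E _ Hin), (E _ Hs) in He.
  replace ((g (s + h') - g (s + h') - (g s - g s)) / h' - d) with (- d) in He by (field; auto).
  rewrite Rabs_Ropp in He; lra.
Qed.

Lemma smooth3_D3 (c : R -> V3) : smooth3 c -> smooth3 (D3 c).
Proof. intros (H1 & H2 & H3); repeat split; now apply smooth_Derive. Qed.

Lemma smooth3_rev (c : R -> V3) : smooth3 c -> smooth3 (fun s => c (- s)).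
Proof.
  intros (H1 & H2 & H3); repeat split;
    [apply (smooth_comp (fun t => v1 (c t))) | apply (smooth_comp (fun t => v2 (c t)))
    | apply (smooth_comp (fun t => v3 (c t)))]; auto using smooth_opp, smooth_id.
Qed.

Lemma D3_eq_on (l : R) (c c' : R -> V3) : 0 < l -> smooth3 c -> smooth3 c' ->
  (forall t, inJ l t -> c t = c' t) -> forall s, inJ l s -> D3 c s = D3 c' s.
Proof.
  intros Hl (H1 & H2 & H3) (H1' & H2' & H3') E s Hs.
  apply V3_ext; apply (Derive_eq_on l); auto using smooth_ex_derive;
    intros t Ht; now rewrite E.
Qed.

Lemma Derive_rev (f : R -> R) (s : R) : ex_derive f (- s) ->
  Derive (fun t => f (- t)) s = - Derive f (- s).
Proof.
  intros H; rewrite (Derive_comp f (fun t => - t)); auto.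
  - rewrite (Derive_opp (fun t => t)), Derive_id; ring.
  - apply (ex_derive_opp (fun t : R => t)), ex_derive_id.
Qed.

Lemma D3_rev (c : R -> V3) (s : R) : smooth3 c ->
  D3 (fun t => c (- t)) s = scal3 (-1) (D3 c (- s)).
Proof.
  intros (H1 & H2 & H3); apply V3_ext; unfold D3; simpl.
  - rewrite (Derive_rev (fun t => v1 (c t))) by now apply smooth_ex_derive. ring.
  - rewrite (Derive_rev (fun t => v2 (c t))) by now apply smooth_ex_derive. ring.
  - rewrite (Derive_rev (fun t => v3 (c t))) by now apply smooth_ex_derive. ring.
Qed.

Lemma smooth_comb (x y z d : R) (f g h : R -> R) : smooth f -> smooth g -> smooth h ->
  smooth (fun t => f t * x + g t * y + h t * z + d).
Proof.
  intros; apply smooth_plus; [apply smooth_plus; [apply smooth_plus|]|];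
    auto using smooth_mult, smooth_const.
Qed.

Lemma is_derive_comb (x y z d : R) (f g h : R -> R) (s : R) : smooth f -> smooth g -> smooth h ->
  is_derive (fun t => f t * x + g t * y + h t * z + d) s
    (Derive f s * x + Derive g s * y + Derive h s * z).
Proof.
  intros Hf Hg Hh.
  apply (smooth_ex_derive f s) in Hf; apply (smooth_ex_derive g s) in Hg;
  apply (smooth_ex_derive h s) in Hh.
  auto_derive; [auto|].
  change (Derive (fun x => f x) s) with (Derive f s).
  change (Derive (fun x => g x) s) with (Derive g s).
  change (Derive (fun x => h x) s) with (Derive h s); ring.
Qed.

Lemma smooth3_lin (u v w t : V3) (c : R -> V3) : smooth3 c ->
  smooth3 (fun s => add3 (lin3 u v w (c s)) t).
Proof.
  intros (H1 & H2 & H3); repeat split; unfold lin3, add3, scal3; cbn [v1 v2 v3]; now apply smooth_comb.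
Qed.

Lemma D3_lin (u v w t : V3) (c : R -> V3) (s : R) : smooth3 c ->
  D3 (fun s => add3 (lin3 u v w (c s)) t) s = lin3 u v w (D3 c s).
Proof.
  intros (H1 & H2 & H3).
  apply V3_ext; unfold D3, lin3, add3, scal3; cbn [v1 v2 v3];
    apply is_derive_unique; now apply is_derive_comb.
Qed.

Lemma smooth_dot (q : V3) (c : R -> V3) : smooth3 c -> smooth (fun t => dot3 q (c t)).
Proof.
  intros (H1 & H2 & H3); unfold dot3; apply smooth_plus; [apply smooth_plus|];
    auto using smooth_mult, smooth_const.
Qed.

Lemma smooth_dot3 (c c' : R -> V3) : smooth3 c -> smooth3 c' -> smooth (fun t => dot3 (c t) (c' t)).
Proof.
  intros (H1 & H2 & H3) (H1' & H2' & H3'); unfold dot3; apply smooth_plus; [apply smooth_plus|];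
    now apply smooth_mult.
Qed.

Lemma Derive_dot (q : V3) (c : R -> V3) (s : R) : smooth3 c ->
  Derive (fun t => dot3 q (c t)) s = dot3 q (D3 c s).
Proof.
  intros (H1 & H2 & H3); apply is_derive_unique.
  apply is_derive_ext with (fun t => v1 (c t) * v1 q + v2 (c t) * v2 q + v3 (c t) * v3 q + 0);
    [intros t; unfold dot3; lra|].
  replace (dot3 q (D3 c s)) with (Derive (fun t => v1 (c t)) s * v1 q
    + Derive (fun t => v2 (c t)) s * v2 q + Derive (fun t => v3 (c t)) s * v3 q)
    by (unfold dot3, D3; simpl; ring).
  now apply is_derive_comb.
Qed.

Lemma smooth_MVT (f : R -> R) (a b : R) : smooth f ->
  exists z, Rmin a b <= z <= Rmax a b /\ f b - f a = Derive f z * (b - a).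
Proof.
  intros H; apply MVT_gen.
  - intros x _; now apply smooth_is_derive.
  - intros x _; apply continuity_pt_filterlim; now apply smooth_continuous.
Qed.

Lemma inJ_between (l a b z : R) : inJ l a -> inJ l b -> Rmin a b <= z <= Rmax a b ->
  inJ l z /\ Rabs (z - a) <= Rabs (b - a).
Proof.
  unfold inJ, Rmin, Rmax; intros Ha Hb; destruct (Rle_dec a b); intros Hz; split; try lra.
  - rewrite !Rabs_pos_eq; lra.
  - rewrite !Rabs_left1; lra.
Qed.

Lemma smooth_bounded (l : R) (f : R -> R) : 0 < l -> smooth f ->
  exists M, forall s, inJ l s -> f s <= M.
Proof.
  intros Hl Hf; destruct (continuity_ab_maj f (- (l / 2)) (l / 2)) as (x & Hx & _); [lra| |].
  - intros s _; apply continuity_pt_filterlim; now apply smooth_continuous.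
  - exists (f x); exact Hx.
Qed.

Lemma dist3_triang (x y z : V3) : dist3 x z <= dist3 x y + dist3 y z.
Proof.
  unfold dist3; replace (sub3 x z) with (add3 (sub3 x y) (sub3 y z)) by vring.
  apply norm3_triang.
Qed.

Section UnitSpeed.

Variables (l : R) (c : R -> V3).
Hypotheses (Hl : 0 < l) (Hc : smooth3 c) (Hu : forall s, inJ l s -> norm3 (D3 c s) = 1).

(** The mean value theorem is applied to the projection of the curve on the chord itself. *)
Lemma unit_dist_le (s t : R) : inJ l s -> inJ l t -> dist3 (c s) (c t) <= Rabs (s - t).
Proof.
  intros Hs Ht; set (u := sub3 (c s) (c t)).
  destruct (smooth_MVT (fun x => dot3 u (c x)) t s (smooth_dot u c Hc)) as (z & Hz & E).
  destruct (inJ_between l t s z Ht Hs Hz) as [Hz' _].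
  rewrite Derive_dot in E by auto.
  replace (dot3 u (c s) - dot3 u (c t)) with (dot3 u u) in E by (unfold u; vring).
  pose proof (dot3_CS u (D3 c z)) as B; rewrite Hu, Rmult_1_r in B by auto.
  pose proof (norm3_pos u) as Hn.
  unfold dist3; fold u; rewrite <- norm3_sqr in E.
  assert (B' : norm3 u * norm3 u <= norm3 u * Rabs (s - t)).
  { rewrite E; eapply Rle_trans; [apply Rle_abs|]; rewrite Rabs_mult.
    apply Rmult_le_compat_r; auto using Rabs_pos. }
  pose proof (Rabs_pos (s - t)).
  destruct (Req_dec (norm3 u) 0) as [Z|Z]; [lra|]; nra.
Qed.

(** The projection on the tangent at [t] has derivative 1 there, and the derivative changes at a
    rate bounded by the second derivative of [c]. As [M] bounds the squared norm of the latter,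
    [1 + Rabs M] bounds the norm. *)
Lemma unit_dist_ge : exists K, 0 <= K /\ forall s t, inJ l s -> inJ l t ->
  Rabs (s - t) - K * (Rabs (s - t) * Rabs (s - t)) <= dist3 (c s) (c t).
Proof.
  pose proof (smooth3_D3 c Hc) as Hc1; pose proof (smooth3_D3 _ Hc1) as Hc2.
  destruct (smooth_bounded l _ Hl (smooth_dot3 _ _ Hc2 Hc2)) as [M HM].
  exists (1 + Rabs M); split; [pose proof (Rabs_pos M); lra|].
  intros s t Hs Ht; set (q := D3 c t).
  destruct (smooth_MVT (fun x => dot3 q (c x)) t s (smooth_dot q c Hc)) as (z & Hz & E).
  destruct (inJ_between l t s z Ht Hs Hz) as [Hz' Dz].
  rewrite Derive_dot in E by auto.
  destruct (smooth_MVT (fun x => dot3 q (D3 c x)) t z (smooth_dot q _ Hc1)) as (y & Hy & E').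
  destruct (inJ_between l t z y Ht Hz' Hy) as [Hy' _].
  rewrite Derive_dot in E' by auto.
  assert (Hq : norm3 q = 1) by (now apply Hu).
  assert (Eq : dot3 q (D3 c t) = 1) by (apply norm3_1; auto).
  pose proof (dot3_CS q (D3 (D3 c) y)) as B; rewrite Hq, Rmult_1_l in B.
  assert (B2 : norm3 (D3 (D3 c) y) <= 1 + Rabs M).
  { pose proof (norm3_sqr (D3 (D3 c) y)); specialize (HM y Hy'); pose proof (Rle_abs M).
    pose proof (Rabs_pos M); pose proof (norm3_pos (D3 (D3 c) y)); nra. }
  pose proof (dot3_CS q (sub3 (c s) (c t))) as B3; rewrite Hq, Rmult_1_l in B3.
  fold (dist3 (c s) (c t)) in B3.
  replace (dot3 q (sub3 (c s) (c t))) with (dot3 q (c s) - dot3 q (c t)) in B3 by vring.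
  rewrite E, Rabs_mult in B3.
  eapply Rle_trans; [|exact B3].
  assert (B4 : 1 - (1 + Rabs M) * Rabs (s - t) <= Rabs (dot3 q (D3 c z))).
  { eapply Rle_trans; [|apply Rle_abs].
    assert (Rabs (dot3 q (D3 (D3 c) y) * (z - t)) <= (1 + Rabs M) * Rabs (s - t)).
    { rewrite Rabs_mult; apply Rmult_le_compat; auto using Rabs_pos; lra. }
    pose proof (Rle_abs (- (dot3 q (D3 (D3 c) y) * (z - t)))) as B5; rewrite Rabs_Ropp in B5.
    lra. }
  apply Rmult_le_compat_r with (r := Rabs (s - t)) in B4; auto using Rabs_pos; lra.
Qed.

Hypothesis Hinj : forall s t, inJ l s -> inJ l t -> c s = c t -> s = t.

(** Compactness of the square [J x J]: near the diagonal the quadratic lower bound applies, away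
    from it injectivity keeps the chord away from 0. Locally one number [d] serves both as radius
    and as Lipschitz constant, which is what a uniform lower bound on radii needs. *)
Lemma bilipschitz : exists k, 0 < k /\ forall s t, inJ l s -> inJ l t ->
  k * Rabs (s - t) <= dist3 (c s) (c t).
Proof.
  destruct unit_dist_ge as (K & HK & G).
  assert (loc : forall p : R * R, exists d : posreal, inJ l (fst p) -> inJ l (snd p) ->
    forall x y, inJ l x -> inJ l y -> Rabs (x - fst p) < d -> Rabs (y - snd p) < d ->
    d * Rabs (x - y) <= dist3 (c x) (c y)).
  { intros [u v]; simpl; destruct (Req_dec u v) as [E|E].
    - subst v.
      (* With [|x - y| <= 2 * d] the quadratic term removes less than half of [|x - y|]. *)
      assert (Hd : 0 < / (4 * K + 4)) by (apply Rinv_0_lt_compat; lra).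
      exists (mkposreal _ Hd); simpl; intros _ _ x y Hx Hy Dx Dy.
      set (d := / (4 * K + 4)) in *.
      assert (Ed : 4 * (K * d) + 4 * d = 1) by (unfold d; field; lra).
      pose proof (G x y Hx Hy) as B; pose proof (Rabs_pos (x - y)).
      assert (D : Rabs (x - y) <= 2 * d).
      { replace (x - y) with ((x - u) - (y - u)) by ring.
        pose proof (Rabs_triang (x - u) (- (y - u))) as T; rewrite Rabs_Ropp in T.
        replace (x - u + - (y - u)) with (x - u - (y - u)) in T by ring; lra. }
      assert (K * Rabs (x - y) <= K * (2 * d)) by (apply Rmult_le_compat_l; auto).
      assert (0 <= K * d) by (apply Rmult_le_pos; lra).
      nra.
    - set (m := dist3 (c u) (c v)).
      destruct (classic (inJ l u /\ inJ l v)) as [[Hu' Hv']|N];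
        [|exists (mkposreal 1 Rlt_0_1); simpl; tauto].
      assert (Hm : 0 < m).
      { destruct (norm3_pos (sub3 (c u) (c v))) as [H|H]; auto.
        exfalso; apply E, Hinj, dist3_eq0; auto. }
      (* Moving each end by [m / 4] leaves a chord of at least [m / 2], while [|x - y| <= l]. *)
      assert (Hd : 0 < Rmin (m / 4) (m / (2 * l)))
        by (apply Rmin_glb_lt; [lra | apply Rdiv_lt_0_compat; lra]).
      exists (mkposreal _ Hd); simpl; intros _ _ x y Hx Hy Dx Dy.
      pose proof (Rmin_l (m / 4) (m / (2 * l))); pose proof (Rmin_r (m / 4) (m / (2 * l))).
      set (d := Rmin (m / 4) (m / (2 * l))) in *.
      assert (m <= dist3 (c u) (c x) + dist3 (c x) (c y) + dist3 (c y) (c v)).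
      { pose proof (dist3_triang (c u) (c x) (c v)); pose proof (dist3_triang (c x) (c y) (c v)).
        unfold m; lra. }
      pose proof (unit_dist_le u x Hu' Hx) as B1; rewrite Rabs_minus_sym in B1.
      pose proof (unit_dist_le y v Hy Hv') as B2.
      assert (Rabs (x - y) <= l) by (unfold inJ in *; apply Rabs_le; lra).
      assert (d * Rabs (x - y) <= m / (2 * l) * l)
        by (apply Rmult_le_compat; auto using Rabs_pos; lra).
      replace (m / (2 * l) * l) with (m / 2) in * by (field; lra).
      lra. }
  set (delta u v := proj1_sig (constructive_indefinite_description _ (loc (u, v)))).
  destruct (compactness_value_2d (- (l / 2)) (l / 2) (- (l / 2)) (l / 2) delta) as [d Hd].
  exists d; split; [apply cond_pos|].
  intros s t Hs Ht.
  (* The compactness result yields its covering point only under a double negation. *)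
  apply NNPP; intros N; apply (Hd s t Hs Ht); intros (u & v & Iu & Iv & D1 & D2 & D).
  apply N; unfold delta in D1, D2, D.
  destruct (constructive_indefinite_description _ (loc (u, v))) as [e He]; simpl in *.
  eapply Rle_trans; [|apply (He Iu Iv s t Hs Ht D1 D2)].
  apply Rmult_le_compat_r; auto using Rabs_pos.
Qed.

End UnitSpeed.

(* Bisecting [[s, t]] halves the quadratic error at each step. *)
Lemma lipschitz1_of_quadratic (l M : R) (phi : R -> R) :
  (forall s t, inJ l s -> inJ l t ->
     Rabs (phi s - phi t) <= Rabs (s - t) + M * (Rabs (s - t) * Rabs (s - t))) ->
  forall s t, inJ l s -> inJ l t -> Rabs (phi s - phi t) <= Rabs (s - t).
Proof.
  intros H.
  assert (Q : forall n s t, inJ l s -> inJ l t ->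
    Rabs (phi s - phi t) <= Rabs (s - t) + M * (Rabs (s - t) * Rabs (s - t)) * (/ 2) ^ n).
  { induction n as [|n IH]; intros s t Hs Ht.
    - simpl; rewrite Rmult_1_r; auto.
    - set (m := (s + t) / 2).
      assert (Hm : inJ l m) by (unfold inJ, m in *; lra).
      pose proof (IH s m Hs Hm) as A; pose proof (IH m t Hm Ht) as B.
      assert (E1 : Rabs (s - m) = Rabs (s - t) / 2).
      { replace (s - m) with ((s - t) / 2) by (unfold m; field).
        rewrite Rabs_div, (Rabs_pos_eq 2); lra. }
      assert (E2 : Rabs (m - t) = Rabs (s - t) / 2).
      { replace (m - t) with ((s - t) / 2) by (unfold m; field).
        rewrite Rabs_div, (Rabs_pos_eq 2); lra. }
      rewrite E1 in A; rewrite E2 in B.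
      pose proof (Rabs_triang (phi s - phi m) (phi m - phi t)) as T.
      replace (phi s - phi m + (phi m - phi t)) with (phi s - phi t) in T by ring.
      simpl; lra. }
  intros s t Hs Ht.
  set (a := Rabs (phi s - phi t) - Rabs (s - t)).
  set (b := M * (Rabs (s - t) * Rabs (s - t))).
  assert (L : Rbar_le a 0).
  { apply (is_lim_seq_le (fun _ => a) (fun n => b * (/ 2) ^ n) a 0).
    - intros n; specialize (Q n s t Hs Ht); unfold a, b; lra.
    - apply is_lim_seq_const.
    - replace (Finite 0) with (Rbar_mult b 0) by (simpl; f_equal; ring).
      apply is_lim_seq_scal_l, is_lim_seq_geom; rewrite Rabs_pos_eq; lra. }
  simpl in L; unfold a in L; lra.
Qed.

(** A metric argument on the change of parameter [phi]: it is 1-Lipschitz up to a quadratic error,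
    hence 1-Lipschitz, and it maps [J] onto [J]. Points sent to the two ends are then at distance at
    least [l], so they are the ends themselves, and distances to the ends determine [phi]. *)
Lemma unit_speed_unique (l : R) (c1 c2 : R -> V3) : 0 < l ->
  smooth3 c1 -> (forall s, inJ l s -> norm3 (D3 c1 s) = 1) ->
  smooth3 c2 -> (forall s, inJ l s -> norm3 (D3 c2 s) = 1) ->
  (forall s t, inJ l s -> inJ l t -> c1 s = c1 t -> s = t) ->
  (forall s, inJ l s -> exists t, inJ l t /\ c1 t = c2 s) ->
  (forall t, inJ l t -> exists s, inJ l s /\ c2 s = c1 t) ->
  (forall s, inJ l s -> c2 s = c1 s) \/ (forall s, inJ l s -> c2 s = c1 (- s)).
Proof.
  intros Hl H1 U1 H2 U2 I1 Hex Hsur.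
  assert (Hch : forall s, exists t, inJ l s -> inJ l t /\ c1 t = c2 s).
  { intros s; destruct (classic (inJ l s)) as [Hs|Hs]; [|exists 0; tauto].
    destruct (Hex s Hs) as [t Ht]; exists t; auto. }
  set (phi s := proj1_sig (constructive_indefinite_description _ (Hch s))).
  assert (Hphi : forall s, inJ l s -> inJ l (phi s) /\ c1 (phi s) = c2 s).
  { intros s; unfold phi; now destruct (constructive_indefinite_description _ (Hch s)). }
  clearbody phi; clear Hch.
  destruct (bilipschitz l c1 Hl H1 U1 I1) as (k & Hk & Bk).
  destruct (unit_dist_ge l c1 Hl H1 U1) as (K & HK & BK).
  (* The common chord is at most [q] along [c2] and at least [p - K * p ^ 2] along [c1]; the
     bi-Lipschitz bound [p <= q / k] converts the error into one in [q]. *)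
  assert (Q : forall s t, inJ l s -> inJ l t -> Rabs (phi s - phi t)
     <= Rabs (s - t) + K / (k * k) * (Rabs (s - t) * Rabs (s - t))).
  { intros s t Hs Ht.
    destruct (Hphi s Hs) as [Is Es]; destruct (Hphi t Ht) as [It Et].
    pose proof (Bk _ _ Is It) as A; pose proof (BK _ _ Is It) as B.
    rewrite Es, Et in A, B.
    pose proof (unit_dist_le l c2 H2 U2 s t Hs Ht) as D.
    set (p := Rabs (phi s - phi t)) in *; set (q := Rabs (s - t)) in *.
    assert (0 <= p) by apply Rabs_pos; assert (0 <= q) by apply Rabs_pos.
    assert (p * p <= (q * q) / (k * k)).
    { apply Rmult_le_reg_r with (k * k); [nra|].
      replace (q * q / (k * k) * (k * k)) with (q * q) by (field; lra).
      assert (k * p <= q) by lra. assert (0 <= k * p) by (apply Rmult_le_pos; lra).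
      nra. }
    assert (K * (p * p) <= K * ((q * q) / (k * k))) by (apply Rmult_le_compat_l; auto).
    replace (K / (k * k) * (q * q)) with (K * (q * q / (k * k))) by (field; lra).
    lra. }
  pose proof (lipschitz1_of_quadratic l _ phi Q) as L.
  assert (Sphi : forall t, inJ l t -> exists s, inJ l s /\ phi s = t).
  { intros t Ht; destruct (Hsur t Ht) as (s & Hs & E); exists s; split; auto.
    destruct (Hphi s Hs) as [Is Es]; apply I1; auto; now rewrite Es. }
  assert (Ja : inJ l (- (l / 2))) by (unfold inJ; lra).
  assert (Jb : inJ l (l / 2)) by (unfold inJ; lra).
  destruct (Sphi _ Ja) as (x & Hx & Ex); destruct (Sphi _ Jb) as (y & Hy & Ey).
  pose proof (L x y Hx Hy) as Lxy; rewrite Ex, Ey in Lxy.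
  replace (- (l / 2) - l / 2) with (- l) in Lxy by field.
  rewrite Rabs_Ropp, Rabs_pos_eq in Lxy by lra.
  unfold Rabs in Lxy; destruct (Rcase_abs (x - y)) as [Hxy|Hxy].
  - left; intros s Hs.
    assert (x = - (l / 2)) by (unfold inJ in *; lra).
    assert (y = l / 2) by (unfold inJ in *; lra); subst x y.
    destruct (Hphi s Hs) as [Is Es].
    rewrite <- Es; f_equal.
    (* The two distance bounds squeeze [phi s] from below and from above. *)
    pose proof (L s _ Hs Hx) as A; pose proof (L s _ Hs Hy) as B.
    rewrite Ex in A; rewrite Ey in B.
    apply Rabs_le_between in A; apply Rabs_le_between in B.
    unfold inJ in Hs; rewrite Rabs_pos_eq in A by lra; rewrite Rabs_left1 in B by lra; lra.
  - right; intros s Hs.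
    assert (y = - (l / 2)) by (unfold inJ in *; lra).
    assert (x = l / 2) by (unfold inJ in *; lra); subst x y.
    destruct (Hphi s Hs) as [Is Es].
    rewrite <- Es; f_equal.
    pose proof (L s _ Hs Hx) as A; pose proof (L s _ Hs Hy) as B.
    rewrite Ex in A; rewrite Ey in B.
    apply Rabs_le_between in A; apply Rabs_le_between in B.
    unfold inJ in Hs; rewrite Rabs_left1 in A by lra; rewrite Rabs_pos_eq in B by lra; lra.
Qed.

(** * Rulings under motions and reversal *)


Lemma norm3_opp (x : V3) : norm3 (scal3 (-1) x) = norm3 x.
Proof. rewrite norm3_scal, Rabs_left1 by lra; ring. Qed.

Lemma norm3_sign (d : R) (x : V3) : d = 1 \/ d = -1 -> norm3 (scal3 d x) = norm3 x.
Proof.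
  intros [-> | ->]; [|apply norm3_opp].
  rewrite norm3_scal, Rabs_R1; ring.
Qed.

(** * Dependence on the values on the parameter interval *)

Section EqualOnJ.

Variables (l : R) (c c' : R -> V3).
Hypotheses (Hl : 0 < l) (Hc : smooth3 c) (Hc' : smooth3 c')
  (E : forall t, inJ l t -> c t = c' t).

Lemma derivatives_eq_on (s : R) : inJ l s ->
  D3 c s = D3 c' s /\ D3 (D3 c) s = D3 (D3 c') s /\ D3 (D3 (D3 c)) s = D3 (D3 (D3 c')) s.
Proof.
  intros Hs.
  assert (E1 : forall t, inJ l t -> D3 c t = D3 c' t) by (now apply D3_eq_on).
  assert (E2 : forall t, inJ l t -> D3 (D3 c) t = D3 (D3 c') t)
    by (apply D3_eq_on; auto using smooth3_D3).
  assert (E3 : forall t, inJ l t -> D3 (D3 (D3 c)) t = D3 (D3 (D3 c')) t)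
    by (apply D3_eq_on; auto using smooth3_D3).
  auto.
Qed.

Lemma curv_eq_on (s : R) : inJ l s -> curv c s = curv c' s.
Proof.
  intros Hs; destruct (derivatives_eq_on s Hs) as (E1 & E2 & _).
  unfold curv; now rewrite E1, E2.
Qed.

Lemma ruling_eq_on (a a' : R -> R) (s : R) : smooth a -> smooth a' ->
  (forall t, inJ l t -> a t = a' t) -> inJ l s -> ruling c a s = ruling c' a' s.
Proof.
  intros Ha Ha' Ea Hs; destruct (derivatives_eq_on s Hs) as (E1 & E2 & E3).
  assert (Ed : Derive a s = Derive a' s)
    by (apply (Derive_eq_on l); auto using smooth_ex_derive).
  unfold ruling, beta, curv, tors, prnorm, binorm, tang.
  now rewrite E1, E2, E3, Ed, Ea.
Qed.

Lemma origami_eq_on (a a' : R -> R) (s v : R) : smooth a -> smooth a' ->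
  (forall t, inJ l t -> a t = a' t) -> inJ l s -> origami c a s v = origami c' a' s v.
Proof.
  intros Ha Ha' Ea Hs; unfold origami, strip.
  rewrite (E s Hs); destruct (Rle_dec 0 v); f_equal; f_equal; apply ruling_eq_on;
    auto using smooth_opp; intros t Ht; now rewrite Ea.
Qed.

Lemma img_eq_on (a a' : R -> R) (eps : R) (x : V3) : smooth a -> smooth a' ->
  (forall t, inJ l t -> a t = a' t) -> img l (c, a) eps x <-> img l (c', a') eps x.
Proof.
  intros Ha Ha' Ea; unfold img; simpl; split; intros (s & v & Hs & Hv & ->);
    exists s, v; repeat split; try apply Hs; try apply Hv;
    [| symmetry]; now apply origami_eq_on.
Qed.

End EqualOnJ.

(** * Behaviour under isometries *)

Section Motion.

Variables (T : V3 -> V3) (u v w t : V3) (d : R).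
Hypothesis HT : motion T u v w t d.

Let L := lin3 u v w.

Lemma lin3_scal (k : R) (x : V3) : scal3 k (L x) = L (scal3 k x).
Proof. unfold L, lin3; vring. Qed.

Lemma lin3_add (x y : V3) : add3 (L x) (L y) = L (add3 x y).
Proof. unfold L, lin3; vring. Qed.

Lemma motion_eq : T = fun x => add3 (L x) t.
Proof. apply functional_extensionality; apply HT. Qed.

Lemma motion_isometry : isometry3 T.
Proof. rewrite motion_eq; apply lin3_isometry, HT. Qed.

Lemma motion_det (x0 x1 x2 x3 : V3) :
  det3 (sub3 (T x1) (T x0)) (sub3 (T x2) (T x0)) (sub3 (T x3) (T x0))
  = d * det3 (sub3 x1 x0) (sub3 x2 x0) (sub3 x3 x0).
Proof.
  destruct HT as (Ho & Hd & H1 & H2 & H3 & E).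
  assert (S : forall x y, sub3 (T x) (T y) = L (sub3 x y))
    by (intros x y; rewrite !E; unfold L, lin3; vring).
  rewrite !S; unfold L; now apply lin3_det.
Qed.

Variable c : R -> V3.
Hypothesis Hc : smooth3 c.

Lemma smooth3_motion : smooth3 (fun s => T (c s)).
Proof. rewrite motion_eq; now apply smooth3_lin. Qed.

Lemma D3_motion : D3 (fun s => T (c s)) = fun s => L (D3 c s).
Proof. rewrite motion_eq; apply functional_extensionality; intros s; now apply D3_lin. Qed.

Lemma D3_L (f : R -> V3) : smooth3 f -> D3 (fun s => L (f s)) = fun s => L (D3 f s).
Proof.
  intros Hf; apply functional_extensionality; intros s.
  replace (fun s => L (f s)) with (fun s => add3 (lin3 u v w (f s)) zero3).
  - now apply D3_lin.
  - apply functional_extensionality; intros x; unfold L, lin3, zero3; vring.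
Qed.

Lemma D3_2_motion : D3 (D3 (fun s => T (c s))) = fun s => L (D3 (D3 c) s).
Proof. rewrite D3_motion; apply D3_L; auto using smooth3_D3. Qed.

Lemma D3_3_motion : D3 (D3 (D3 (fun s => T (c s)))) = fun s => L (D3 (D3 (D3 c)) s).
Proof. rewrite D3_2_motion; apply D3_L; auto using smooth3_D3. Qed.

Lemma cross3_motion (x y : V3) : cross3 (L x) (L y) = scal3 d (L (cross3 x y)).
Proof. unfold L; apply lin3_cross; apply HT. Qed.

Lemma norm3_motion (x : V3) : norm3 (L x) = norm3 x.
Proof. apply lin3_norm, HT. Qed.

Lemma curv_motion (s : R) : curv (fun s => T (c s)) s = curv c s.
Proof.
  unfold curv; rewrite D3_2_motion, D3_motion, cross3_motion, norm3_sign, !norm3_motion;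
    [reflexivity | apply HT].
Qed.

(** Torsion, the derivative of the angle and its sine all acquire the factor [d], so the second
    angular function is unchanged. The binormal acquires [d] as well, which [sin (d * a s)]
    compensates; the principal normal acquires it twice. *)
Lemma ruling_motion (a : R -> R) (s : R) : smooth a ->
  ruling (fun s => T (c s)) (fun s => d * a s) s = L (ruling c a s).
Proof.
  intros Ha.
  assert (Hd : d = 1 \/ d = -1) by apply HT.
  assert (Hb : beta (fun s => T (c s)) (fun s => d * a s) s = beta c a s).
  { unfold beta; rewrite curv_motion; unfold tors.
    rewrite D3_3_motion, D3_2_motion, D3_motion, cross3_motion, norm3_sign, !norm3_motion by auto.
    rewrite Derive_scal.
    unfold L at 1 2 3; rewrite (lin3_det u v w d) by apply HT.
    do 2 f_equal; destruct Hd as [-> | ->].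
    - now rewrite !Rmult_1_l.
    - replace (-1 * a s) with (- a s) by ring; rewrite sin_neg.
      set (N := norm3 (D3 c s)); set (k := curv c s).
      replace (N * k * - sin (a s)) with (- (N * k * sin (a s))) by ring.
      unfold Rdiv; rewrite Rinv_opp; ring. }
  unfold ruling; rewrite Hb.
  assert (Ht : tang (fun s => T (c s)) s = L (tang c s))
    by (unfold tang; now rewrite D3_motion, norm3_motion, lin3_scal).
  assert (Hbn : binorm (fun s => T (c s)) s = scal3 d (L (binorm c s))).
  { unfold binorm; rewrite D3_2_motion, D3_motion, cross3_motion, norm3_sign, norm3_motion by auto.
    rewrite !lin3_scal; f_equal; vring. }
  assert (Hpn : prnorm (fun s => T (c s)) s = L (prnorm c s)).
  { unfold prnorm; rewrite Ht, Hbn.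
    transitivity (scal3 d (cross3 (L (binorm c s)) (L (tang c s)))); [vring|].
    rewrite cross3_motion.
    transitivity (scal3 (d * d) (L (cross3 (binorm c s) (tang c s)))); [vring|].
    replace (d * d) with 1 by (destruct Hd; subst; ring); vring. }
  rewrite Ht, Hbn, Hpn, <- !lin3_add, <- !lin3_scal, <- lin3_add, <- !lin3_scal.
  replace (cos (d * a s)) with (cos (a s)).
  - replace (sin (d * a s)) with (d * sin (a s)).
    + replace (scal3 (d * sin (a s)) (scal3 d (L (binorm c s))))
        with (scal3 (d * d) (scal3 (sin (a s)) (L (binorm c s)))) by vring.
      replace (d * d) with 1 by (destruct Hd; subst; ring).
      f_equal; f_equal; f_equal; vring.
    + destruct Hd as [-> | ->]; [now rewrite !Rmult_1_l|].
      replace (-1 * a s) with (- a s) by ring; rewrite sin_neg; ring.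
  - destruct Hd as [-> | ->]; [now rewrite !Rmult_1_l|].
    replace (-1 * a s) with (- a s) by ring; now rewrite cos_neg.
Qed.

Lemma origami_motion (a : R -> R) (s r : R) : smooth a ->
  origami (fun s => T (c s)) (fun s => d * a s) s r = T (origami c a s r).
Proof.
  intros Ha.
  assert (S : forall a, smooth a ->
    strip (fun s => T (c s)) (fun s => d * a s) s r = T (strip c a s r)).
  { intros b Hb; unfold strip; rewrite ruling_motion by auto; rewrite motion_eq.
    unfold L, lin3; vring. }
  unfold origami.
  replace (fun t0 => - (d * a t0)) with (fun t0 => d * - a t0)
    by (apply functional_extensionality; intros; ring).
  destruct (Rle_dec 0 r); apply (S _); auto using smooth_opp.
Qed.

Lemma img_motion (l : R) (a : R -> R) (eps : R) (y : V3) : smooth a ->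
  img l (fun s => T (c s), fun s => d * a s) eps y <-> exists x, img l (c, a) eps x /\ T x = y.
Proof.
  intros Ha; unfold img; cbn [fst snd]; split.
  - intros (s & r & Hs & Hr & ->); exists (origami c a s r); split; eauto 6.
    symmetry; now apply origami_motion.
  - intros (x & (s & r & Hs & Hr & ->) & <-); exists s, r; repeat split; try apply Hs; try apply Hr.
    symmetry; now apply origami_motion.
Qed.

End Motion.

(** * Behaviour under reversal of the parameter *)

Section Reversal.

Variable c : R -> V3.
Hypothesis Hc : smooth3 c.

Let cr := fun s => c (- s).

Lemma D3_scal (k : R) (f : R -> V3) :
  D3 (fun s => scal3 k (f s)) = fun s => scal3 k (D3 f s).
Proof.
  apply functional_extensionality; intros s.
  apply V3_ext; unfold D3, scal3; cbn [v1 v2 v3]; apply Derive_scal.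
Qed.

Lemma D3_1_rev : D3 cr = fun s => scal3 (-1) (D3 c (- s)).
Proof. apply functional_extensionality; intros; now apply D3_rev. Qed.

Lemma D3_2_rev : D3 (D3 cr) = fun s => D3 (D3 c) (- s).
Proof.
  rewrite D3_1_rev, (D3_scal (-1) (fun s => D3 c (- s))).
  apply functional_extensionality; intros s.
  rewrite D3_rev by auto using smooth3_D3; vring.
Qed.

Lemma D3_3_rev : D3 (D3 (D3 cr)) = fun s => scal3 (-1) (D3 (D3 (D3 c)) (- s)).
Proof.
  rewrite D3_2_rev; apply functional_extensionality; intros s.
  apply D3_rev; auto using smooth3_D3.
Qed.

Lemma curv_rev (s : R) : curv cr s = curv c (- s).
Proof.
  unfold curv; rewrite D3_2_rev, D3_1_rev, norm3_opp.
  replace (cross3 (scal3 (-1) (D3 c (- s))) (D3 (D3 c) (- s)))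
    with (scal3 (-1) (cross3 (D3 c (- s)) (D3 (D3 c) (- s)))) by vring.
  now rewrite norm3_opp.
Qed.

(** Reversal flips the tangent and the binormal but keeps the principal normal, the curvature and
    the torsion. The sine of the new angle changes sign while its derivative does not, so [beta]
    becomes [PI - beta]; its cosine then cancels the flip of the tangent, and the sine of the angle
    that of the binormal. *)
Lemma ruling_rev (a : R -> R) (s : R) : smooth a ->
  ruling cr (fun s => - a (- s)) s = ruling c a (- s).
Proof.
  intros Ha.
  assert (Hx : cross3 (D3 cr s) (D3 (D3 cr) s)
     = scal3 (-1) (cross3 (D3 c (- s)) (D3 (D3 c) (- s))))
    by (rewrite D3_2_rev, D3_1_rev; vring).
  assert (Hb : beta cr (fun s => - a (- s)) s = PI - beta c a (- s)).
  { unfold beta; rewrite curv_rev; unfold tors; rewrite Hx, norm3_opp, D3_3_rev, D3_2_rev, D3_1_rev.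
    rewrite norm3_opp, sin_neg.
    replace (Derive (fun s => - a (- s)) s) with (Derive a (- s))
      by (rewrite (Derive_opp (fun s => a (- s))), Derive_rev by auto using smooth_ex_derive; ring).
    replace (det3 (scal3 (-1) (D3 c (- s))) (D3 (D3 c) (- s)) (scal3 (-1) (D3 (D3 (D3 c)) (- s))))
      with (det3 (D3 c (- s)) (D3 (D3 c) (- s)) (D3 (D3 (D3 c)) (- s))) by vring.
    set (X := _ + _); set (N := norm3 (D3 c (- s))); set (k := curv c (- s)).
    replace (N * k * - sin (a (- s))) with (- (N * k * sin (a (- s)))) by ring.
    replace (X / - (N * k * sin (a (- s)))) with (- (X / (N * k * sin (a (- s)))))
      by (unfold Rdiv; rewrite Rinv_opp; ring).
    rewrite atan_opp; field. }
  unfold ruling; rewrite Hb, cos_neg, sin_neg, sin_PI_x.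
  replace (cos (PI - beta c a (- s))) with (- cos (beta c a (- s)))
    by (unfold Rminus; rewrite cos_plus, cos_neg, sin_neg, cos_PI, sin_PI; ring).
  unfold prnorm, binorm, tang; rewrite Hx, D3_1_rev, !norm3_opp.
  vring.
Qed.

Lemma origami_rev (a : R -> R) (s v : R) : smooth a ->
  origami cr (fun s => - a (- s)) s v = origami c a (- s) v.
Proof.
  intros Ha; unfold origami, strip.
  destruct (Rle_dec 0 v); unfold cr at 1; f_equal; f_equal;
    [now apply ruling_rev | now apply (ruling_rev (fun t => - a t)); apply smooth_opp].
Qed.

Lemma img_rev (l : R) (a : R -> R) (eps : R) (x : V3) : smooth a ->
  img l (cr, fun s => - a (- s)) eps x <-> img l (c, a) eps x.
Proof.
  intros Ha; unfold img; cbn [fst snd]; split; intros (s & v & Hs & Hv & ->);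
    exists (- s), v; (split; [unfold inJ in *; lra | split; [assumption|]]).
  - now apply origami_rev.
  - rewrite origami_rev, Ropp_involutive by auto; reflexivity.
Qed.

End Reversal.

(** * Rigidity of the folded image *)


Lemma curv_unit (c : R -> V3) (s : R) : norm3 (D3 c s) = 1 ->
  curv c s = norm3 (cross3 (D3 c s) (D3 (D3 c) s)).
Proof. intros H; unfold curv; rewrite H; field. Qed.

Lemma frenet_orthonormal (c : R -> V3) (s : R) : norm3 (D3 c s) = 1 -> curv c s <> 0 ->
  orthonormal (tang c s) (prnorm c s) (binorm c s).
Proof.
  intros Hu Hk; rewrite curv_unit in Hk by auto.
  assert (Ht : dot3 (tang c s) (tang c s) = 1).
  { unfold tang; rewrite Hu, Rinv_1.
    transitivity (dot3 (D3 c s) (D3 c s)); [vring | now apply norm3_1]. }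
  assert (Hb : dot3 (binorm c s) (binorm c s) = 1).
  { unfold binorm; set (x := cross3 _ _) in *.
    transitivity (/ norm3 x * / norm3 x * dot3 x x); [vring|].
    rewrite <- norm3_sqr; field; auto. }
  assert (Htb : dot3 (tang c s) (binorm c s) = 0) by (unfold tang, binorm; vring).
  unfold prnorm; repeat split; auto; try vring.
  set (b := binorm c s) in *; set (e := tang c s) in *.
  transitivity (dot3 b b * dot3 e e - dot3 e b * dot3 e b); [vring|].
  rewrite Ht, Hb, Htb; ring.
Qed.

Lemma sin_beta_pos (c : R -> V3) (a : R -> R) (s : R) : 0 < sin (beta c a s).
Proof.
  unfold beta; rewrite sin_shift; set (X := _ / _).
  pose proof (atan_bound X); apply cos_gt_0; lra.
Qed.

Lemma ruling_unit (c : R -> V3) (a : R -> R) (s : R) : norm3 (D3 c s) = 1 -> curv c s <> 0 ->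
  norm3 (ruling c a s) = 1.
Proof.
  intros Hu Hk; destruct (frenet_orthonormal c s Hu Hk) as (H1 & H2 & H3 & H4 & H5 & H6).
  unfold ruling; set (e := tang c s) in *; set (n := prnorm c s) in *; set (b := binorm c s) in *.
  unfold norm3; rewrite <- sqrt_1; f_equal.
  set (cb := cos (beta c a s)); set (sb := sin (beta c a s)).
  transitivity (cb * cb * dot3 e e + sb * sb * (cos (a s) * cos (a s) * dot3 n n
    + sin (a s) * sin (a s) * dot3 b b + 2 * cos (a s) * sin (a s) * dot3 n b)
    + 2 * cb * sb * (cos (a s) * dot3 e n + sin (a s) * dot3 e b)); [vring|].
  rewrite H1, H2, H3, H4, H5, H6.
  pose proof (sin2_cos2 (beta c a s)) as P1; pose proof (sin2_cos2 (a s)) as P2.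
  fold cb sb in P1; unfold Rsqr in P1, P2.
  replace (cos (a s) * cos (a s)) with (1 - sin (a s) * sin (a s)) by lra.
  replace (cb * cb) with (1 - sb * sb) by lra; ring.
Qed.

(** Normal vectors do not see the tangential part of the ruling: up to the positive factor
    [sin beta] only the direction at angle [a s] remains. *)
Lemma ruling_dot (c : R -> V3) (a : R -> R) (s p q : R) :
  norm3 (D3 c s) = 1 -> curv c s <> 0 ->
  dot3 (add3 (scal3 p (prnorm c s)) (scal3 q (binorm c s))) (ruling c a s)
  = sin (beta c a s) * (p * cos (a s) + q * sin (a s)).
Proof.
  intros Hu Hk; destruct (frenet_orthonormal c s Hu Hk) as (H1 & H2 & H3 & H4 & H5 & H6).
  unfold ruling; set (e := tang c s) in *; set (n := prnorm c s) in *; set (b := binorm c s) in *.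
  set (cb := cos (beta c a s)); set (sb := sin (beta c a s)).
  transitivity (cb * (p * dot3 e n + q * dot3 e b)
    + sb * (p * cos (a s) * dot3 n n + q * sin (a s) * dot3 b b
       + (p * sin (a s) + q * cos (a s)) * dot3 n b)); [vring|].
  rewrite H2, H3, H4, H5, H6; ring.
Qed.

(** * Continuity of the ruling *)

Definition cont3 (f : R -> V3) (s : R) : Prop :=
  continuous (fun t => v1 (f t)) s /\ continuous (fun t => v2 (f t)) s /\
  continuous (fun t => v3 (f t)) s.

Lemma continuous_Rplus (f g : R -> R) (s : R) : continuous f s -> continuous g s ->
  continuous (fun t => f t + g t) s.
Proof. intros; now apply (continuous_plus f g). Qed.

Lemma continuous_Rminus (f g : R -> R) (s : R) : continuous f s -> continuous g s ->
  continuous (fun t => f t - g t) s.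
Proof. intros; now apply (continuous_minus f g). Qed.

Lemma continuous_Rmult (f g : R -> R) (s : R) : continuous f s -> continuous g s ->
  continuous (fun t => f t * g t) s.
Proof. intros; now apply (continuous_mult f g). Qed.

Lemma cont3_smooth (f : R -> V3) (s : R) : smooth3 f -> cont3 f s.
Proof. intros (H1 & H2 & H3); repeat split; now apply smooth_continuous. Qed.

Lemma cont3_add (f g : R -> V3) (s : R) : cont3 f s -> cont3 g s ->
  cont3 (fun t => add3 (f t) (g t)) s.
Proof.
  intros (H1 & H2 & H3) (K1 & K2 & K3); repeat split; unfold add3; cbn [v1 v2 v3];
    now apply continuous_Rplus.
Qed.

Lemma cont3_sub (f g : R -> V3) (s : R) : cont3 f s -> cont3 g s ->
  cont3 (fun t => sub3 (f t) (g t)) s.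
Proof.
  intros (H1 & H2 & H3) (K1 & K2 & K3); repeat split; unfold sub3; cbn [v1 v2 v3];
    now apply continuous_Rminus.
Qed.

Lemma cont3_scal (k : R -> R) (f : R -> V3) (s : R) : continuous k s -> cont3 f s ->
  cont3 (fun t => scal3 (k t) (f t)) s.
Proof.
  intros Hk (H1 & H2 & H3); repeat split; unfold scal3; cbn [v1 v2 v3];
    now apply continuous_Rmult.
Qed.

Lemma cont3_cross (f g : R -> V3) (s : R) : cont3 f s -> cont3 g s ->
  cont3 (fun t => cross3 (f t) (g t)) s.
Proof.
  intros (H1 & H2 & H3) (K1 & K2 & K3); repeat split; unfold cross3; cbn [v1 v2 v3];
    apply continuous_Rminus; now apply continuous_Rmult.
Qed.

Lemma continuous_dot3 (f g : R -> V3) (s : R) : cont3 f s -> cont3 g s ->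
  continuous (fun t => dot3 (f t) (g t)) s.
Proof.
  intros (H1 & H2 & H3) (K1 & K2 & K3); unfold dot3;
    apply continuous_Rplus; [apply continuous_Rplus|]; now apply continuous_Rmult.
Qed.

Lemma continuous_norm3 (f : R -> V3) (s : R) : cont3 f s -> continuous (fun t => norm3 (f t)) s.
Proof.
  intros H; apply (continuous_comp (fun t => dot3 (f t) (f t)) sqrt).
  - now apply continuous_dot3.
  - apply continuous_sqrt.
Qed.

Lemma continuous_inv (f : R -> R) (s : R) : continuous f s -> f s <> 0 ->
  continuous (fun t => / f t) s.
Proof. intros; now apply continuous_Rinv_comp. Qed.

Lemma continuous_pow (f : R -> R) (n : nat) (s : R) : continuous f s ->
  continuous (fun t => f t ^ n) s.
Proof.
  intros H; induction n as [|n IH]; simpl; [apply continuous_const | now apply continuous_Rmult].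
Qed.

(** Serves to compare rulings at nearby crease points. The conditions are imposed at [s] alone,
    since non-vanishing of the denominators there suffices and unit speed may fail outside [J]. *)
Lemma cont3_ruling (c : R -> V3) (a : R -> R) (s : R) : smooth3 c -> smooth a ->
  norm3 (D3 c s) = 1 -> curv c s <> 0 -> sin (a s) <> 0 -> cont3 (ruling c a) s.
Proof.
  intros Hc Ha Hu Hk Hs.
  assert (H1 : cont3 (D3 c) s) by (apply cont3_smooth, smooth3_D3; auto).
  assert (H2 : cont3 (D3 (D3 c)) s) by (apply cont3_smooth, smooth3_D3, smooth3_D3; auto).
  assert (H3 : cont3 (D3 (D3 (D3 c))) s)
    by (apply cont3_smooth, smooth3_D3, smooth3_D3, smooth3_D3; auto).
  assert (HX : cont3 (fun t => cross3 (D3 c t) (D3 (D3 c) t)) s) by (now apply cont3_cross).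
  assert (HN : continuous (fun t => norm3 (D3 c t)) s) by (now apply continuous_norm3).
  assert (HXN : continuous (fun t => norm3 (cross3 (D3 c t) (D3 (D3 c) t))) s)
    by (now apply continuous_norm3).
  assert (Hk' : norm3 (cross3 (D3 c s) (D3 (D3 c) s)) <> 0) by (now rewrite <- curv_unit).
  assert (Hsin : continuous (fun t => sin (a t)) s)
    by (apply continuous_sin_comp, smooth_continuous; auto).
  assert (Hcos : continuous (fun t => cos (a t)) s)
    by (apply continuous_cos_comp, smooth_continuous; auto).
  assert (Htang : cont3 (tang c) s)
    by (apply cont3_scal; auto; apply continuous_inv; auto; lra).
  assert (Hbin : cont3 (binorm c) s)
    by (apply cont3_scal; auto; apply continuous_inv; auto).
  assert (Hpr : cont3 (prnorm c) s) by (now apply cont3_cross).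
  assert (Hcurv : continuous (curv c) s).
  { apply continuous_Rmult; auto; apply continuous_inv; [now apply continuous_pow|].
    rewrite Hu; lra. }
  assert (Htors : continuous (tors c) s).
  { apply continuous_Rmult.
    - apply continuous_dot3; auto; now apply cont3_cross.
    - apply continuous_inv; [now apply continuous_pow | now apply pow_nonzero]. }
  assert (Hbeta : continuous (beta c a) s).
  { apply continuous_Rminus; [apply continuous_const|].
    apply (continuous_comp (fun t => (Derive a t + norm3 (D3 c t) * tors c t)
                 / (norm3 (D3 c t) * curv c t * sin (a t))) atan);
      [| apply smooth_continuous, smooth_atan].
    apply continuous_Rmult.
    - apply continuous_Rplus; [apply smooth_continuous, smooth_Derive; auto|].
      now apply continuous_Rmult.
    - apply continuous_inv; [apply continuous_Rmult; auto; now apply continuous_Rmult|].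
      rewrite Hu, Rmult_1_l; now apply Rmult_integral_contrapositive. }
  apply cont3_add; apply cont3_scal; auto.
  - now apply continuous_cos_comp.
  - now apply continuous_sin_comp.
  - apply cont3_add; now apply cont3_scal.
Qed.

(** Second-order Taylor estimate: orthogonality to the tangent removes the first-order term. The
    constant is uniform in [q] and [s]. *)
Lemma unit_normal_quadratic (l : R) (c : R -> V3) : 0 < l -> smooth3 c ->
  exists K, 0 <= K /\ forall q s t, inJ l s -> inJ l t -> norm3 q = 1 -> dot3 q (D3 c s) = 0 ->
  Rabs (dot3 q (sub3 (c t) (c s))) <= K * (Rabs (t - s) * Rabs (t - s)).
Proof.
  intros Hl Hc.
  pose proof (smooth3_D3 c Hc) as Hc1; pose proof (smooth3_D3 _ Hc1) as Hc2.
  destruct (smooth_bounded l _ Hl (smooth_dot3 _ _ Hc2 Hc2)) as [M HM].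
  exists (1 + Rabs M); split; [pose proof (Rabs_pos M); lra|].
  intros q s t Hs Ht Hq H0.
  destruct (smooth_MVT (fun x => dot3 q (c x)) s t (smooth_dot q c Hc)) as (z & Hz & E).
  destruct (inJ_between l s t z Hs Ht Hz) as [Hz' Dz].
  rewrite Derive_dot in E by auto.
  destruct (smooth_MVT (fun x => dot3 q (D3 c x)) s z (smooth_dot q _ Hc1)) as (y & Hy & E').
  destruct (inJ_between l s z y Hs Hz' Hy) as [Hy' _].
  rewrite Derive_dot, H0, Rminus_0_r in E' by auto.
  pose proof (dot3_CS q (D3 (D3 c) y)) as B; rewrite Hq, Rmult_1_l in B.
  assert (B2 : norm3 (D3 (D3 c) y) <= 1 + Rabs M).
  { pose proof (norm3_sqr (D3 (D3 c) y)); specialize (HM y Hy'); pose proof (Rle_abs M).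
    pose proof (Rabs_pos M); pose proof (norm3_pos (D3 (D3 c) y)); nra. }
  replace (dot3 q (sub3 (c t) (c s))) with (dot3 q (c t) - dot3 q (c s)) by vring.
  rewrite E, E', !Rabs_mult, <- Rmult_assoc.
  apply Rmult_le_compat_r; [apply Rabs_pos|].
  apply Rmult_le_compat; auto using Rabs_pos; lra.
Qed.

Definition angular (l : R) (a : R -> R) : Prop :=
  smooth a /\ forall s, inJ l s -> - (PI / 2) < a s < PI / 2 /\ a s <> 0.

Lemma angular_opp (l : R) (a : R -> R) : angular l a -> angular l (fun s => - a s).
Proof.
  intros [H1 H2]; split; [now apply smooth_opp|].
  intros s Hs; specialize (H2 s Hs); lra.
Qed.

Lemma angular_sin (l : R) (a : R -> R) (s : R) : angular l a -> inJ l s ->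
  sin (a s) <> 0 /\ 0 < cos (a s).
Proof.
  intros [_ H] Hs; destruct (H s Hs) as [H1 H2]; split.
  - intros Z; destruct (Rtotal_order (a s) 0) as [L|[L|L]]; [|tauto|].
    + pose proof (sin_lt_0_var (a s)) as Q; pose proof PI_RGT_0; lra.
    + pose proof (sin_gt_0 (a s)) as Q; pose proof PI_RGT_0; lra.
  - apply cos_gt_0; lra.
Qed.

Lemma small_positive (e d M A B : R) : 0 < e -> 0 < d -> 0 <= M -> 0 < A -> 0 < B ->
  exists v, 0 < v /\ v < e /\ v < d /\ M * v < A /\ M * v < B.
Proof.
  intros He Hd HM HA HB.
  (* Dividing by [M + 1] also covers [M = 0]. *)
  set (m := Rmin (Rmin e d) (Rmin (A / (M + 1)) (B / (M + 1)))).
  assert (0 < A / (M + 1)) by (apply Rdiv_lt_0_compat; lra).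
  assert (0 < B / (M + 1)) by (apply Rdiv_lt_0_compat; lra).
  assert (Hm : 0 < m) by (repeat apply Rmin_glb_lt; auto).
  assert (m <= e /\ m <= d /\ m <= A / (M + 1) /\ m <= B / (M + 1)) as (M1 & M2 & M3 & M4).
  { unfold m; pose proof (Rmin_l (Rmin e d) (Rmin (A / (M + 1)) (B / (M + 1))));
    pose proof (Rmin_r (Rmin e d) (Rmin (A / (M + 1)) (B / (M + 1))));
    pose proof (Rmin_l e d); pose proof (Rmin_r e d);
    pose proof (Rmin_l (A / (M + 1)) (B / (M + 1)));
    pose proof (Rmin_r (A / (M + 1)) (B / (M + 1))); lra. }
  exists (m / 2); repeat split; try lra.
  - apply Rmult_le_compat_r with (r := M + 1) in M3; [|lra].
    replace (A / (M + 1) * (M + 1)) with A in M3 by (field; lra). nra.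
  - apply Rmult_le_compat_r with (r := M + 1) in M4; [|lra].
    replace (B / (M + 1) * (M + 1)) with B in M4 by (field; lra). nra.
Qed.

Lemma continuous_near (f : R -> R) (x e : R) : continuous f x -> 0 < e ->
  exists d, 0 < d /\ forall y, Rabs (y - x) < d -> Rabs (f y - f x) < e.
Proof.
  intros Hc He.
  destruct (Hc (fun z => Rabs (z - f x) < e)) as [d Hd].
  { exists (mkposreal _ He); intros z Hz; exact Hz. }
  exists d; split; [apply d|]; intros y Hy; now apply Hd.
Qed.

Section Rigidity.

Variables (l : R) (c : R -> V3).
Hypotheses (Hl : 0 < l) (Hc : smooth3 c) (Hu : forall s, inJ l s -> norm3 (D3 c s) = 1)
  (Hinj : forall s t, inJ l s -> inJ l t -> c s = c t -> s = t)
  (Hk : forall s, inJ l s -> curv c s <> 0).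

Lemma crease_in_img (a : R -> R) (s eps : R) : inJ l s -> 0 < eps -> img l (c, a) eps (c s).
Proof.
  intros Hs He; exists s, 0; repeat split; try apply Hs; try lra.
  unfold origami, strip; cbn [fst snd].
  destruct (Rle_dec 0 0); [|lra]; generalize (ruling c a s); intros; vring.
Qed.

Lemma origami_dist (a : R -> R) (s v : R) : inJ l s ->
  exists xi, norm3 xi = 1 /\ origami c a s v = add3 (c s) (scal3 v xi).
Proof.
  intros Hs; unfold origami, strip; destruct (Rle_dec 0 v);
    eexists; (split; [|reflexivity]); apply ruling_unit; auto.
Qed.

(** Rulings have unit length, so a point of the image of width [eps] is closer than [eps] to the
    crease. The distance to the crease is attained by compactness, hence a positive one is
    excluded. *)
Lemma img_shrinks_to_crease (a : R -> R) (eps0 : R) (x : V3) : 0 < eps0 ->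
  (forall eps, 0 < eps < eps0 -> img l (c, a) eps x) -> exists s, inJ l s /\ c s = x.
Proof.
  intros He H.
  set (f s := dot3 (sub3 x (c s)) (sub3 x (c s))).
  assert (Hf : forall s, continuous f s).
  { intros s.
    assert (Q : cont3 (fun t => sub3 x (c t)) s)
      by (apply cont3_sub; [repeat split; apply continuous_const | now apply cont3_smooth]).
    now apply continuous_dot3. }
  destruct (continuity_ab_min f (- (l / 2)) (l / 2)) as (z & Hz & Iz); [lra| |].
  { intros s _; apply continuity_pt_filterlim, Hf. }
  exists z; split; auto.
  symmetry; apply dist3_eq0; unfold dist3.
  set (m := norm3 (sub3 x (c z))).
  destruct (norm3_pos (sub3 x (c z))) as [P|P]; auto; exfalso; fold m in P.
  set (e := Rmin (eps0 / 2) m).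
  assert (0 < e) by (apply Rmin_glb_lt; lra).
  assert (e <= eps0 / 2) by apply Rmin_l; assert (e <= m) by apply Rmin_r.
  destruct (H e ltac:(lra)) as (s & v & Hs & Hv & E); cbn [fst snd] in E.
  destruct (origami_dist a s v Hs) as (xi & Hxi & E'); rewrite E' in E.
  specialize (Hz s Hs); unfold f in Hz; rewrite <- !norm3_sqr in Hz; fold m in Hz.
  replace (sub3 x (c s)) with (scal3 v xi) in Hz by (rewrite E; vring).
  rewrite norm3_scal, Hxi, Rmult_1_r in Hz.
  assert (Rabs v < e) by (apply Rabs_def1; lra).
  pose proof (Rabs_pos v); nra.
Qed.

(* A small step along the ray at angle [a s] is matched with the two rays of [b]; the normal
   component of the displacement along the crease is only quadratic in the step. *)
Lemma img_determines_angle (a b : R -> R) (eps0 s : R) : angular l a -> angular l b -> 0 < eps0 ->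
  (forall eps x, 0 < eps < eps0 -> img l (c, a) eps x -> img l (c, b) eps x) ->
  inJ l s -> a s = b s.
Proof.
  intros Ha Hb He Himg Hs.
  apply NNPP; intros Hne.
  pose proof (Hu s Hs) as Hus; pose proof (Hk s Hs) as Hks.
  destruct (frenet_orthonormal c s Hus Hks) as (O1 & O2 & O3 & O4 & O5 & O6).
  (* Two tests: [q1] is the principal normal and separates the two sides of the fold; [q2] is normal
     to the ray of [b] at [s] and measures the deviation [sin (a s - b s)]. *)
  set (q1 := add3 (scal3 1 (prnorm c s)) (scal3 0 (binorm c s))).
  set (q2 := add3 (scal3 (- sin (b s)) (prnorm c s)) (scal3 (cos (b s)) (binorm c s))).
  assert (Qn : forall p q, p * p + q * q = 1 ->
     norm3 (add3 (scal3 p (prnorm c s)) (scal3 q (binorm c s))) = 1).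
  { intros p q Hpq; unfold norm3; rewrite <- sqrt_1; f_equal.
    transitivity (p * p * dot3 (prnorm c s) (prnorm c s) + q * q * dot3 (binorm c s) (binorm c s)
       + 2 * p * q * dot3 (prnorm c s) (binorm c s)); [vring|].
    rewrite O2, O3, O5; lra. }
  assert (N1 : norm3 q1 = 1) by (apply Qn; ring).
  assert (N2 : norm3 q2 = 1).
  { apply Qn; pose proof (sin2_cos2 (b s)) as P; unfold Rsqr in P; lra. }
  assert (Qt : forall p q, dot3 (add3 (scal3 p (prnorm c s)) (scal3 q (binorm c s))) (D3 c s) = 0).
  { intros p q.
    assert (Et : D3 c s = tang c s) by (unfold tang; rewrite Hus, Rinv_1; vring).
    rewrite Et.
    transitivity (p * dot3 (tang c s) (prnorm c s) + q * dot3 (tang c s) (binorm c s)); [vring|].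
    rewrite O4, O6; ring. }
  destruct (angular_sin l a s Ha Hs) as [Sa Ca]; destruct (angular_sin l b s Hb Hs) as [Sb Cb].
  pose proof (sin_beta_pos c a s) as Ba.
  set (A := dot3 q1 (ruling c a s)).
  set (B := dot3 q2 (ruling c a s)).
  assert (HA : 0 < A) by (unfold A, q1; rewrite ruling_dot by auto; nra).
  assert (HB : B <> 0).
  { unfold B, q2; rewrite ruling_dot by auto.
    replace (- sin (b s) * cos (a s) + cos (b s) * sin (a s)) with (sin (a s - b s))
      by (rewrite sin_minus; ring).
    apply Rmult_integral_contrapositive; split; [lra|].
    destruct Ha as [_ Ha], Hb as [_ Hb]; specialize (Ha s Hs); specialize (Hb s Hs).
    destruct (Rtotal_order (a s) (b s)) as [L|[L|L]]; [|tauto|].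
    - apply Rlt_not_eq, sin_lt_0_var; lra.
    - apply Rgt_not_eq, sin_gt_0; lra. }
  assert (HB' : 0 < Rabs B / 4) by (pose proof (Rabs_pos_lt B HB); lra).
  assert (Hzero : dot3 q2 (ruling c b s) = 0) by (unfold q2; rewrite ruling_dot by auto; ring).
  assert (Hpos : 0 < dot3 q1 (ruling c (fun t => - b t) s)).
  { unfold q1; rewrite ruling_dot, cos_neg by auto.
    pose proof (sin_beta_pos c (fun t => - b t) s); nra. }
  assert (Hcont : forall q a, angular l a -> continuous (fun t => dot3 q (ruling c a t)) s).
  { intros q f Hf; apply continuous_dot3; [repeat split; apply continuous_const|].
    apply cont3_ruling; auto; [apply Hf | now apply (angular_sin l f s Hf Hs)]. }
  destruct (continuous_near _ s _ (Hcont q2 b Hb) HB') as (d1 & Hd1 & C1).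
  destruct (continuous_pos_near _ s (Hcont q1 _ (angular_opp l b Hb)) Hpos) as (d2 & Hd2 & C2).
  destruct (bilipschitz l c Hl Hc Hu Hinj) as (k & Hkp & Bk).
  destruct (unit_normal_quadratic l c Hl Hc) as (K & HK & BK).
  set (d := Rmin d1 d2).
  assert (Hd : 0 < d) by (now apply Rmin_glb_lt).
  assert (d <= d1) by apply Rmin_l; assert (d <= d2) by apply Rmin_r.
  (* From [k * |t - s| <= 3 * v] the quadratic normal error is at most [M * v ^ 2]. *)
  set (M := 9 * K / (k * k)).
  assert (HM : 0 <= M) by (apply Rmult_le_pos; [lra | left; apply Rinv_0_lt_compat; nra]).
  destruct (small_positive (eps0 / 2) (d * k / 3) M A (Rabs B / 4)) as
    (v & Hv & V1 & V2 & V3 & V4); auto; try lra.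
  { assert (0 < d * k) by nra; lra. }
  (* Width [2 * v] admits the point at parameter [v] and also bounds the unknown parameter by
     [|w| < 2 * v]; together they give the [3 * v] below. *)
  assert (Hin : img l (c, b) (2 * v) (add3 (c s) (scal3 v (ruling c a s)))).
  { apply Himg; [lra|]; exists s, v; repeat split; try apply Hs; try lra.
    unfold origami, strip; cbn [fst snd]; destruct (Rle_dec 0 v); [reflexivity | lra]. }
  destruct Hin as (t & w & Ht & Hw & E); cbn [fst snd] in E.
  assert (Dts : k * Rabs (t - s) <= 3 * v).
  { eapply Rle_trans; [apply Bk; auto|].
    destruct (origami_dist b t w Ht) as (xi & Hxi & E'); rewrite E' in E.
    unfold dist3; replace (sub3 (c t) (c s))
      with (add3 (scal3 v (ruling c a s)) (scal3 (- w) xi)).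
    - eapply Rle_trans; [apply norm3_triang|].
      rewrite !norm3_scal, Hxi, ruling_unit, Rabs_Ropp, (Rabs_pos_eq v) by (auto; lra).
      assert (Rabs w <= 2 * v) by (apply Rabs_le; lra); lra.
    - apply V3_ext; [apply (f_equal v1) in E | apply (f_equal v2) in E | apply (f_equal v3) in E];
        unfold add3, sub3, scal3 in *; cbn [v1 v2 v3] in *; lra. }
  pose proof (Rabs_pos (t - s)) as Pts.
  assert (Hts : Rabs (t - s) < d) by nra.
  assert (Hsq : K * (Rabs (t - s) * Rabs (t - s)) <= M * v * v).
  { replace (M * v * v) with (K * ((3 * v) * (3 * v) / (k * k))) by (unfold M; field; lra).
    apply Rmult_le_compat_l; auto.
    apply Rmult_le_reg_r with (k * k); [nra|].
    replace (3 * v * (3 * v) / (k * k) * (k * k)) with (3 * v * (3 * v)) by (field; lra).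
    assert (0 <= k * Rabs (t - s)) by (apply Rmult_le_pos; lra); nra. }
  pose proof (BK q1 s t Hs Ht N1 (Qt _ _)) as Q1; pose proof (BK q2 s t Hs Ht N2 (Qt _ _)) as Q2.
  apply Rabs_le_between in Q1.
  unfold origami, strip in E; destruct (Rle_dec 0 w) as [W|W].
  (* On the ray of [b] the [q2]-component is below [3 / 4 * v * |B|] in absolute value, yet it has
     to be [v * |B|]. *)
  - apply (f_equal (fun x => dot3 q2 (sub3 x (c s)))) in E.
    replace (dot3 q2 (sub3 (add3 (c s) (scal3 v (ruling c a s))) (c s))) with (v * B) in E
      by (unfold B; generalize q2 (ruling c a s); intros; vring).
    replace (dot3 q2 (sub3 (add3 (c t) (scal3 w (ruling c b t))) (c s)))
      with (dot3 q2 (sub3 (c t) (c s)) + w * dot3 q2 (ruling c b t)) in E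
      by (generalize q2 (ruling c b t); intros; vring).
    specialize (C1 t ltac:(lra)); rewrite Hzero, Rminus_0_r in C1.
    assert (G : v * Rabs B <= M * v * v + 2 * v * (Rabs B / 4)).
    { rewrite <- (Rabs_pos_eq v) at 1 by lra; rewrite <- Rabs_mult, E.
      eapply Rle_trans; [apply Rabs_triang|].
      apply Rplus_le_compat; [lra|].
      rewrite Rabs_mult, (Rabs_pos_eq w) by lra.
      apply Rmult_le_compat; auto using Rabs_pos; lra. }
    assert (v * (M * v) < v * (Rabs B / 4)) by (apply Rmult_lt_compat_l; lra).
    nra.
  (* On the dual side [w] is negative and the ruling has positive [q1]-component, so that the total
     is at most [M * v ^ 2 < v * A]. *)
  - apply (f_equal (fun x => dot3 q1 (sub3 x (c s)))) in E.
    replace (dot3 q1 (sub3 (add3 (c s) (scal3 v (ruling c a s))) (c s))) with (v * A) in E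
      by (unfold A; generalize q1 (ruling c a s); intros; vring).
    replace (dot3 q1 (sub3 (add3 (c t) (scal3 w (ruling c (fun t => - b t) t))) (c s)))
      with (dot3 q1 (sub3 (c t) (c s)) + w * dot3 q1 (ruling c (fun t => - b t) t)) in E
      by (generalize q1 (ruling c (fun t => - b t) t); intros; vring).
    specialize (C2 t ltac:(lra)); simpl in C2.
    assert (w * dot3 q1 (ruling c (fun t => - b t) t) <= 0) by nra.
    assert (v * (M * v) < v * A) by (apply Rmult_lt_compat_l; lra).
    lra.
Qed.

End Rigidity.

(** * Symmetric plane curves *)


Lemma inJ_0 (l : R) : 0 < l -> inJ l 0.
Proof. unfold inJ; lra. Qed.

Lemma inJ_opp (l s : R) : inJ l s -> inJ l (- s).
Proof. unfold inJ; lra. Qed.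

Lemma constant_on (l : R) (f : R -> R) : 0 < l -> smooth f ->
  (forall s, inJ l s -> Derive f s = 0) -> forall s, inJ l s -> f s = f 0.
Proof.
  intros Hl Hf H s Hs.
  destruct (smooth_MVT f 0 s Hf) as (z & Hz & E).
  destruct (inJ_between l 0 s z (inJ_0 l Hl) Hs Hz) as [Hz' _].
  rewrite H in E by auto; lra.
Qed.

Lemma constant_sign (l : R) (f : R -> R) : 0 < l -> smooth f -> (forall s, inJ l s -> f s <> 0) ->
  (forall s, inJ l s -> 0 < f s) \/ (forall s, inJ l s -> f s < 0).
Proof.
  intros Hl Hf Hn.
  assert (Hc : continuity f).
  { intros x; apply continuity_pt_filterlim; now apply smooth_continuous. }
  pose proof (Hn 0 (inJ_0 l Hl)) as H0.
  assert (Hz : forall s, inJ l s -> ~ Rmin (f 0) (f s) <= 0 <= Rmax (f 0) (f s)).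
  { intros s Hs B; destruct (IVT_gen f 0 s 0 Hc B) as (z & Hz & E).
    apply (Hn z); auto; apply (inJ_between l 0 s); auto using inJ_0. }
  destruct (Rlt_dec 0 (f 0)) as [P|P]; [left | right]; intros s Hs; specialize (Hz s Hs);
    apply Rnot_le_lt; intros C; apply Hz; unfold Rmin, Rmax; destruct (Rle_dec (f 0) (f s)); lra.
Qed.

Lemma dot2_pos (x : V2) : 0 <= dot2 x x.
Proof. unfold dot2; nra. Qed.

Lemma isometry2_dot (T : V2 -> V2) (x y : V2) : isometry2 T ->
  dot2 (sub2 (T x) (T y)) (sub2 (T x) (T y)) = dot2 (sub2 x y) (sub2 x y).
Proof.
  intros HT; specialize (HT x y); unfold dist2, norm2 in HT.
  apply sqrt_inj; auto using dot2_pos.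
Qed.

(** Plane curves are placed in space so that the uniqueness of unit-speed parametrizations and the
    invariance of curvature apply to them. *)
Definition embed (x : V2) : V3 := mk3 (w1 x) (w2 x) 0.

Definition lift_map (T : V2 -> V2) (x : V3) : V3 :=
  let y := T (mk2 (v1 x) (v2 x)) in mk3 (w1 y) (w2 y) (v3 x).

Lemma lift_map_isometry (T : V2 -> V2) : isometry2 T -> isometry3 (lift_map T).
Proof.
  intros HT x y; unfold dist3, norm3; f_equal.
  pose proof (isometry2_dot T (mk2 (v1 x) (v2 x)) (mk2 (v1 y) (v2 y)) HT) as E.
  unfold lift_map, dot2, sub2 in *; cbn [w1 w2] in E; unfold3; lra.
Qed.

Lemma lift_map_embed (T : V2 -> V2) (x : V2) : lift_map T (embed x) = embed (T x).
Proof. unfold lift_map, embed; simpl; destruct x; reflexivity. Qed.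

Lemma embed_inj (x y : V2) : embed x = embed y -> x = y.
Proof. intros H; injection H; intros; now apply V2_ext. Qed.

Section PlaneCurve.

Variables (l : R) (gamma : R -> V2).
Hypotheses (Hl : 0 < l) (Hg : smooth2 gamma) (Hu : forall s, inJ l s -> norm2 (D2 gamma s) = 1)
  (Hinj : forall s t, inJ l s -> inJ l t -> gamma s = gamma t -> s = t)
  (Hk : forall s, inJ l s -> curv2 gamma s <> 0).

Let g := fun s => embed (gamma s).
Let Gam := fun y : V2 => exists s, inJ l s /\ gamma s = y.

Lemma smooth3_embed : smooth3 g.
Proof. destruct Hg; repeat split; simpl; auto using smooth_const. Qed.

Lemma D3_embed (f : R -> V2) : D3 (fun s => embed (f s)) = fun s => embed (D2 f s).
Proof.
  apply functional_extensionality; intros s; unfold D3, embed; simpl.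
  apply V3_ext; simpl; auto; apply Derive_const.
Qed.

Lemma curv_embed (s : R) : curv g s = curv2 gamma s.
Proof.
  unfold curv, curv2, g; rewrite !D3_embed; unfold Rdiv; f_equal.
  - unfold norm3; rewrite <- sqrt_Rsqr_abs; f_equal.
    unfold det2, Rsqr, embed; unfold3; ring.
  - f_equal; f_equal; unfold norm3, norm2; f_equal; unfold dot2, embed; unfold3; ring.
Qed.

Lemma unit_embed (s : R) : inJ l s -> norm3 (D3 g s) = 1.
Proof.
  intros Hs; rewrite <- (Hu s Hs); unfold g; rewrite D3_embed.
  unfold norm3, norm2; f_equal; unfold dot2, embed; unfold3; ring.
Qed.

(** The symmetry acts on the parameter by [s] or [- s]. In the first case it fixes [gamma]
    pointwise, which puts [gamma] on the perpendicular bisector of a moved point and its image,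
    against the non-vanishing curvature. In the second, invariance of curvature gives evenness. *)
Lemma plane_symmetry_even : has_sym2 Gam ->
  forall s, inJ l s -> curv2 gamma (- s) = curv2 gamma s.
Proof.
  intros (T & HT & [x Hx] & HA).
  pose proof (lift_map_isometry T HT) as HT3.
  destruct (isometry3_motion _ HT3) as (u & v & w & t & d & HM).
  assert (Hsm : smooth3 (fun s => lift_map T (g s)))
    by (apply (smooth3_motion _ u v w t d HM), smooth3_embed).
  assert (Hun : forall s, inJ l s -> norm3 (D3 (fun s => lift_map T (g s)) s) = 1).
  { intros s Hs; rewrite (D3_motion _ u v w t d HM _ smooth3_embed), (norm3_motion _ u v w t d HM).
    now apply unit_embed. }
  destruct (unit_speed_unique l g (fun s => lift_map T (g s)) Hl smooth3_embed unit_embed Hsm Hun)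
    as [E|E].
  - intros a b Ha Hb E; apply Hinj, embed_inj; auto.
  - intros s Hs; unfold g; rewrite lift_map_embed.
    destruct (proj2 (HA (T (gamma s)))) as (r & Hr & Er); [exists (gamma s); split; auto; exists s; auto|].
    exists r; split; auto; now rewrite Er.
  - intros s Hs.
    destruct (proj1 (HA (gamma s))) as (y & (r & Hr & Er) & Ey); [exists s; auto|].
    exists r; split; auto; unfold g; rewrite lift_map_embed, Er, Ey; reflexivity.
  - exfalso.
    assert (Efix : forall s, inJ l s -> T (gamma s) = gamma s).
    { intros s Hs; apply embed_inj; rewrite <- lift_map_embed; now apply E. }
    set (n := sub2 (T x) x).
    set (q := embed n).
    assert (Hq : forall s, inJ l s -> dot3 q (g s) = (dot2 (T x) (T x) - dot2 x x) / 2).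
    { intros s Hs; pose proof (isometry2_dot T x (gamma s) HT) as D.
      rewrite (Efix s Hs) in D.
      unfold q, n, g, embed, dot2, sub2 in *; unfold3; cbn [w1 w2] in *; lra. }
    pose proof smooth3_embed as Hg3.
    assert (Hq1 : forall s, inJ l s -> dot3 q (D3 g s) = 0).
    { intros s Hs; rewrite <- Derive_dot by auto.
      rewrite (Derive_eq_on l _ (fun _ => (dot2 (T x) (T x) - dot2 x x) / 2));
        auto using smooth_ex_derive, smooth_dot, smooth_const.
      apply Derive_const. }
    assert (Hq2 : dot3 q (D3 (D3 g) 0) = 0).
    { rewrite <- Derive_dot by auto using smooth3_D3.
      rewrite (Derive_eq_on l _ (fun _ => 0));
        auto using smooth_ex_derive, smooth_dot, smooth_const, smooth3_D3, inJ_0.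
      apply Derive_const. }
    specialize (Hq1 0 (inJ_0 l Hl)).
    apply (Hk 0 (inJ_0 l Hl)); unfold curv2.
    replace (det2 (D2 gamma 0) (D2 (D2 gamma) 0)) with 0; [rewrite Rabs_R0; unfold Rdiv; ring|].
    unfold g in Hq1, Hq2; rewrite !D3_embed in Hq2; rewrite D3_embed in Hq1.
    assert (Hn : n <> mk2 0 0).
    { intros Z; apply Hx; apply V2_ext; [apply (f_equal w1) in Z | apply (f_equal w2) in Z];
        unfold n, sub2 in Z; simpl in Z; lra. }
    unfold q in Hq1, Hq2; clearbody n.
    unfold embed in Hq1, Hq2; unfold3; unfold det2; destruct n as [n1 n2]; cbn [w1 w2] in *.
    set (a1 := w1 (D2 gamma 0)) in *; set (a2 := w2 (D2 gamma 0)) in *.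
    set (b1 := w1 (D2 (D2 gamma) 0)) in *; set (b2 := w2 (D2 (D2 gamma) 0)) in *.
    (* First and second derivative are both orthogonal to [n]; eliminating in turn shows that their
       determinant is killed by both coordinates of [n]. *)
    assert (Z1 : n1 * (a1 * b2 - a2 * b1) = 0).
    { transitivity ((n1 * a1 + n2 * a2 + 0 * 0) * b2 - a2 * (n1 * b1 + n2 * b2 + 0 * 0)); [ring|].
      rewrite Hq1, Hq2; ring. }
    assert (Z2 : n2 * (a1 * b2 - a2 * b1) = 0).
    { transitivity (a1 * (n1 * b1 + n2 * b2 + 0 * 0) - (n1 * a1 + n2 * a2 + 0 * 0) * b1); [ring|].
      rewrite Hq1, Hq2; ring. }
    destruct (Rmult_integral _ _ Z1) as [Y1|]; [|lra].
    destruct (Rmult_integral _ _ Z2) as [Y2|]; [|lra].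
    exfalso; apply Hn; now subst.
  - intros s Hs.
    rewrite <- !curv_embed.
    pose proof smooth3_embed as Hg3.
    transitivity (curv (fun s => g (- s)) s); [symmetry; now apply curv_rev|].
    rewrite <- (curv_motion _ u v w t d HM g Hg3 s).
    apply (curv_eq_on l); auto using smooth3_rev; intros r Hr; now rewrite E.
Qed.

(* [gamma'] and the reversed [- gamma' (- s)] rotate at opposite rates, so the reflection
   [[p, q], [q, -p]] exchanging them is constant. *)
Lemma even_plane_symmetry : (forall s, inJ l s -> curv2 gamma (- s) = curv2 gamma s) ->
  has_sym2 Gam.
Proof.
  intros Hev; destruct Hg as [G1 G2].
  set (x := Derive (fun t => w1 (gamma t))); set (y := Derive (fun t => w2 (gamma t))).
  assert (Sx : smooth x) by now apply smooth_Derive.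
  assert (Sy : smooth y) by now apply smooth_Derive.
  pose proof (smooth_Derive x Sx) as Sx'; pose proof (smooth_Derive y Sy) as Sy'.
  set (k s := x s * Derive y s - y s * Derive x s).
  assert (Sk : smooth k) by (apply smooth_minus; now apply smooth_mult).
  assert (Exy : forall s, inJ l s -> x s * x s + y s * y s = 1).
  { intros s Hs; specialize (Hu s Hs).
    unfold norm2, D2, dot2 in Hu; cbn [w1 w2] in Hu; fold (x s) (y s) in Hu.
    rewrite <- (sqrt_sqrt (x s * x s + y s * y s)) by nra; rewrite Hu; ring. }
  assert (Ek : forall s, inJ l s -> curv2 gamma s = Rabs (k s)).
  { intros s Hs; unfold curv2; rewrite (Hu s Hs); unfold k, det2, D2; cbn [w1 w2].
    fold x y. field_simplify; reflexivity. }
  assert (Eort : forall s, inJ l s -> x s * Derive x s + y s * Derive y s = 0).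
  { intros s Hs.
    assert (D : is_derive (fun s => x s * x s + y s * y s) s
       (2 * (x s * Derive x s + y s * Derive y s))).
    { pose proof (smooth_ex_derive x s Sx); pose proof (smooth_ex_derive y s Sy).
      auto_derive; [auto|].
      change (Derive (fun t => x t) s) with (Derive x s).
      change (Derive (fun t => y t) s) with (Derive y s); ring. }
    assert (D0 : Derive (fun s => x s * x s + y s * y s) s = 0).
    { rewrite (Derive_eq_on l _ (fun _ => 1)); auto using smooth_ex_derive, smooth_const.
      - apply Derive_const.
      - eexists; apply D. }
    pose proof (eq_trans (eq_sym (is_derive_unique _ _ _ D)) D0) as D1; lra. }
  assert (Ex' : forall s, inJ l s -> Derive x s = - k s * y s).
  { intros s Hs; specialize (Exy s Hs); specialize (Eort s Hs); unfold k.
    transitivity ((x s * x s + y s * y s) * Derive x s); [rewrite Exy; ring|].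
    transitivity (- (x s * Derive y s - y s * Derive x s) * y s
      + x s * (x s * Derive x s + y s * Derive y s)); [ring | rewrite Eort; ring]. }
  assert (Ey' : forall s, inJ l s -> Derive y s = k s * x s).
  { intros s Hs; specialize (Exy s Hs); specialize (Eort s Hs); unfold k.
    transitivity ((x s * x s + y s * y s) * Derive y s); [rewrite Exy; ring|].
    transitivity ((x s * Derive y s - y s * Derive x s) * x s
      + y s * (x s * Derive x s + y s * Derive y s)); [ring | rewrite Eort; ring]. }
  (* The hypothesis concerns [|k|]; the signed curvature has no zero on [J], so its sign is
     constant. *)
  assert (Kev : forall s, inJ l s -> k (- s) = k s).
  { intros s Hs; pose proof (inJ_opp l s Hs) as Hs'.
    pose proof (Hev s Hs) as H; rewrite !Ek in H by auto.
    destruct (constant_sign l k Hl Sk) as [P|P].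
    - intros r Hr Z; apply (Hk r Hr); rewrite Ek, Z by auto; apply Rabs_R0.
    - rewrite !Rabs_pos_eq in H; auto; left; auto.
    - rewrite !Rabs_left in H by auto; lra. }
  set (p s := y s * y (- s) - x s * x (- s)).
  set (q s := - (x s * y (- s) + y s * x (- s))).
  assert (Srev : forall f, smooth f -> smooth (fun s => f (- s)))
    by (intros f Hf; apply (smooth_comp f); auto using smooth_opp, smooth_id).
  assert (Drev : forall f s, smooth f -> Derive (fun s => f (- s)) s = - Derive f (- s))
    by (intros f s Hf; apply Derive_rev, smooth_ex_derive; auto).
  assert (Sp : smooth p) by (apply smooth_minus; apply smooth_mult; auto).
  assert (Sq : smooth q) by (apply smooth_opp, smooth_plus; apply smooth_mult; auto).
  assert (Dm : forall f h s, smooth f -> smooth h ->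
    Derive (fun s => f s * h (- s)) s = Derive f s * h (- s) - f s * Derive h (- s)).
  { intros f h s Hf Hh; rewrite (Derive_mult f (fun s => h (- s)));
      auto using smooth_ex_derive.
    rewrite Drev by auto; ring. }
  assert (Cp : forall s, inJ l s -> p s = p 0).
  { apply constant_on; auto; intros s Hs; unfold p.
    rewrite (Derive_minus (fun s => y s * y (- s)) (fun s => x s * x (- s)))
      by (apply smooth_ex_derive, smooth_mult; auto).
    rewrite !Dm, !Ex', !Ey', !Kev by auto using inJ_opp; ring. }
  assert (Cq : forall s, inJ l s -> q s = q 0).
  { apply constant_on; auto; intros s Hs; unfold q.
    rewrite (Derive_opp (fun s => x s * y (- s) + y s * x (- s))).
    rewrite (Derive_plus (fun s => x s * y (- s)) (fun s => y s * x (- s)))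
      by (apply smooth_ex_derive, smooth_mult; auto).
    rewrite !Dm, !Ex', !Ey', !Kev by auto using inJ_opp; ring. }
  set (P := p 0) in *; set (Q := q 0) in *.
  assert (HPQ : P * P + Q * Q = 1).
  { unfold P, Q, p, q; rewrite Ropp_0; pose proof (Exy 0 (inJ_0 l Hl)) as H.
    transitivity ((x 0 * x 0 + y 0 * y 0) * (x 0 * x 0 + y 0 * y 0)); [ring | rewrite H; ring]. }
  set (a := w1 (gamma 0)); set (b := w2 (gamma 0)).
  set (T z := mk2 (a + P * (w1 z - a) + Q * (w2 z - b)) (b + Q * (w1 z - a) - P * (w2 z - b))).
  assert (Dlin : forall m A B D s, smooth m -> Derive (fun s => m (- s)
      + A * (w1 (gamma s) - a) + B * (w2 (gamma s) - b) + D) s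
      = - Derive m (- s) + A * x s + B * y s).
  { intros m A B D s Hm; apply is_derive_unique.
    apply is_derive_ext with (fun s => m (- s) * 1 + w1 (gamma s) * A + w2 (gamma s) * B
       + (D - A * a - B * b)); [intros; lra|].
    replace (- Derive m (- s) + A * x s + B * y s)
      with (Derive (fun s => m (- s)) s * 1 + x s * A + y s * B) by (rewrite Drev by auto; ring).
    apply (is_derive_comb 1 A B _ (fun s => m (- s)) (fun s => w1 (gamma s)) (fun s => w2 (gamma s)));
      auto. }
  assert (Slin : forall m A B D, smooth m -> smooth (fun s => m (- s)
      + A * (w1 (gamma s) - a) + B * (w2 (gamma s) - b) + D)).
  { intros m A B D Hm.
    apply smooth_ext with (fun s => m (- s) * 1 + w1 (gamma s) * A + w2 (gamma s) * B
       + (D - A * a - B * b)); [intros; lra|].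
    apply (smooth_comb 1 A B _ (fun s => m (- s)) (fun s => w1 (gamma s)) (fun s => w2 (gamma s)));
      auto. }
  (* [T] fixes [gamma 0], and [gamma (- s) - T (gamma s)] has zero derivative because the reflection
     sends [gamma'(s)] to [- gamma'(- s)]. *)
  assert (HTg : forall s, inJ l s -> T (gamma s) = gamma (- s)).
  { intros s Hs; apply V2_ext; unfold T; cbn [w1 w2].
    - pose proof (constant_on l _ Hl (Slin _ (- P) (- Q) 0 G1)) as C.
      specialize (C ltac:(intros r Hr; rewrite Dlin by auto; fold x; rewrite <- (Cp r Hr), <- (Cq r Hr);
        unfold p, q; transitivity (x (- r) * ((x r * x r + y r * y r) - 1));
        [ring | rewrite Exy by auto; ring]) s Hs).
      simpl in C; rewrite Ropp_0 in C; fold a b in C; lra.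
    - pose proof (constant_on l _ Hl (Slin _ (- Q) P 0 G2)) as C.
      specialize (C ltac:(intros r Hr; rewrite Dlin by auto; fold y; rewrite <- (Cp r Hr), <- (Cq r Hr);
        unfold p, q; transitivity (y (- r) * ((x r * x r + y r * y r) - 1));
        [ring | rewrite Exy by auto; ring]) s Hs).
      simpl in C; rewrite Ropp_0 in C; fold a b in C; lra. }
  exists T; split; [|split].
  - intros z z'; unfold dist2, norm2; f_equal; unfold T, dot2, sub2; cbn [w1 w2].
    set (X := w1 z - w1 z'); set (Y := w2 z - w2 z').
    replace (a + P * (w1 z - a) + Q * (w2 z - b) - (a + P * (w1 z' - a) + Q * (w2 z' - b)))
      with (P * X + Q * Y) by (unfold X, Y; ring).
    replace (b + Q * (w1 z - a) - P * (w2 z - b) - (b + Q * (w1 z' - a) - P * (w2 z' - b)))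
      with (Q * X - P * Y) by (unfold X, Y; ring).
    transitivity ((P * P + Q * Q) * (X * X + Y * Y)); [ring | rewrite HPQ; ring].
  - apply NNPP; intros N.
    assert (F : forall z, T z = z) by (intros z; apply NNPP; intros M; apply N; eauto).
    (* Fixing these two points would require both [P = 1] and [P = -1]. *)
    pose proof (f_equal w1 (F (mk2 (a + 1) b))) as F1.
    pose proof (f_equal w2 (F (mk2 a (b + 1)))) as F2.
    unfold T in F1, F2; cbn [w1 w2] in F1, F2; lra.
  - intros z; unfold Gam; split.
    + intros (s & Hs & <-); exists (gamma (- s)); split; [exists (- s); auto using inJ_opp|].
      rewrite HTg by auto using inJ_opp; now rewrite Ropp_involutive.
    + intros (z' & (s & Hs & <-) & <-); exists (- s); split; auto using inJ_opp.
      symmetry; auto.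
Qed.

End PlaneCurve.

(** * Congruence classes of curved foldings *)


Lemma smooth3_cross (f g : R -> V3) : smooth3 f -> smooth3 g ->
  smooth3 (fun t => cross3 (f t) (g t)).
Proof.
  intros (H1 & H2 & H3) (K1 & K2 & K3); repeat split; unfold cross3; cbn [v1 v2 v3];
    apply smooth_minus; now apply smooth_mult.
Qed.

(** The angle is the arc cosine of [f / curv c], written through [atan], which is smooth everywhere.
    Only the radicand, the squared curvature minus [f ^ 2], has to be extended positively beyond
    [J]. *)
Lemma angle_of_geodesic_curvature (l : R) (c : R -> V3) (f : R -> R) : 0 < l -> smooth3 c ->
  (forall s, inJ l s -> norm3 (D3 c s) = 1) -> smooth f ->
  (forall s, inJ l s -> 0 < f s < curv c s) ->
  exists A, smooth A /\ forall s, inJ l s -> 0 < A s < PI / 2 /\ curv c s * cos (A s) = f s.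
Proof.
  intros Hl Hc Hu Hf Hb.
  set (X t := cross3 (D3 c t) (D3 (D3 c) t)).
  assert (SX : smooth3 X) by (apply smooth3_cross; auto using smooth3_D3).
  (* Unlike the curvature, [q] involves neither a root nor a quotient and is smooth on the whole
     line. *)
  set (q s := dot3 (X s) (X s)).
  assert (Eq : forall s, inJ l s -> q s = curv c s * curv c s)
    by (intros s Hs; rewrite curv_unit by auto; symmetry; apply norm3_sqr).
  destruct (smooth_pos_extension (l / 2) (fun s => q s - f s * f s)) as (r & Sr & Pr & Er).
  - lra.
  - apply smooth_minus; [now apply smooth_dot3 | now apply smooth_mult].
  - intros s Hs; rewrite Eq by auto; specialize (Hb s Hs); nra.
  - set (y s := f s * / sqrt (r s)).
    assert (Hr : forall s, 0 < sqrt (r s)) by (intros s; now apply sqrt_lt_R0).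
    exists (fun s => PI / 2 - atan (y s)); split.
    + apply smooth_minus; [apply smooth_const|].
      apply (smooth_comp atan); [apply smooth_atan|].
      apply smooth_mult; auto; apply smooth_inv; [|now apply smooth_sqrt].
      intros s; specialize (Hr s); lra.
    + intros s Hs; specialize (Hb s Hs); specialize (Hr s).
      assert (Hy : 0 < y s) by (apply Rmult_lt_0_compat; [lra | now apply Rinv_0_lt_compat]).
      split.
      * pose proof (atan_bound (y s)); pose proof (atan_increasing 0 (y s) Hy) as I.
        rewrite atan_0 in I; lra.
      * rewrite cos_shift, sin_atan.
        set (k := curv c s) in *.
        assert (E1 : sqrt (1 + (y s)²) = k * / sqrt (r s)).
        { rewrite <- (sqrt_Rsqr (k * / sqrt (r s)))
            by (apply Rmult_le_pos; [lra | left; now apply Rinv_0_lt_compat]).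
          f_equal; unfold Rsqr, y.
          assert (S : sqrt (r s) * sqrt (r s) = k * k - f s * f s)
            by (rewrite sqrt_sqrt by (left; apply Pr); unfold k; rewrite <- Eq by auto; now apply Er).
          apply Rmult_eq_reg_r with (sqrt (r s) * sqrt (r s)); [|nra].
          transitivity (sqrt (r s) * sqrt (r s) + f s * f s); [field; lra|].
          transitivity (k * k); [rewrite S; ring | field; lra]. }
        rewrite E1; unfold y; field; lra.
Qed.

Lemma congruent_of_img (l : R) (F G : (R -> V3) * (R -> R)) :
  (forall eps x, img l F eps x <-> img l G eps x) -> congruent l F G.
Proof.
  intros H; exists (fun x => x); split; [intros x y; reflexivity|].
  exists 1; split; [lra|]; intros eps _ y; rewrite <- H; split.
  - intros Hy; eauto.
  - intros (x & Hx & <-); auto.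
Qed.

Lemma congruent_sym (l : R) (F G : (R -> V3) * (R -> R)) : congruent l F G -> congruent l G F.
Proof.
  intros (T & HT & e & He & H).
  destruct (isometry3_inverse T HT) as (S & HS & ST & TS).
  exists S; split; auto; exists e; split; auto; intros eps Heps y; split.
  - intros Hy; exists (T y); split; auto; apply H; eauto.
  - intros (x & Hx & <-); apply H in Hx; auto; destruct Hx as (z & Hz & <-); now rewrite ST.
Qed.

Lemma congruent_trans (l : R) (F G H : (R -> V3) * (R -> R)) :
  congruent l F G -> congruent l G H -> congruent l F H.
Proof.
  intros (T & HT & e & He & E) (S & HS & e' & He' & E').
  exists (fun x => S (T x)); split; [now apply isometry3_comp|].
  pose proof (Rmin_l e e'); pose proof (Rmin_r e e').
  exists (Rmin e e'); split; [now apply Rmin_glb_lt|]; intros eps Heps y.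
  rewrite E' by lra; split.
  - intros (x & Hx & <-); apply E in Hx; [|lra]; destruct Hx as (z & Hz & <-); eauto.
  - intros (x & Hx & <-); exists (T x); split; auto; apply E; [lra | eauto].
Qed.

(** * Counting classes *)

Lemma num_classes_one {X : Type} (P : X -> Prop) (cong : X -> X -> Prop) (x0 : X) :
  P x0 -> (forall x, P x -> cong x x0) -> num_classes P cong 1.
Proof.
  intros H0 H; exists (fun _ => x0); split; [|split]; auto.
  - intros i j Hi Hj N; lia.
  - intros x Hx; exists 0%nat; auto.
Qed.

Lemma num_classes_le_two {X : Type} (P : X -> Prop) (cong : X -> X -> Prop) (x0 x1 : X) :
  (forall x y, cong x y -> cong y x) -> (forall x y z, cong x y -> cong y z -> cong x z) ->
  P x0 -> P x1 -> (forall x, P x -> cong x x0 \/ cong x x1) ->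
  exists k, (k <= 2)%nat /\ num_classes P cong k.
Proof.
  intros Hs Ht H0 H1 H; destruct (classic (cong x0 x1)) as [C|C].
  - exists 1%nat; split; auto; apply num_classes_one with x0; auto.
    intros x Hx; destruct (H x Hx) as [|D]; eauto.
  - exists 2%nat; split; auto.
    exists (fun i => match i with O => x0 | _ => x1 end); split; [|split].
    + intros [|i]; auto.
    + intros [|[|i]] [|[|j]] Hi Hj N; auto; try lia.
    + intros x Hx; destruct (H x Hx); [exists 0%nat | exists 1%nat]; auto.
Qed.

Lemma motion_of_det (T : V3 -> V3) (d : R) : isometry3 T ->
  (forall x0 x1 x2 x3, det3 (sub3 (T x1) (T x0)) (sub3 (T x2) (T x0)) (sub3 (T x3) (T x0))
     = d * det3 (sub3 x1 x0) (sub3 x2 x0) (sub3 x3 x0)) ->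
  exists u v w t, motion T u v w t d.
Proof.
  intros HT Hd; destruct (isometry3_motion T HT) as (u & v & w & t & d' & HM).
  exists u, v, w, t; replace d with d'; auto.
  pose proof (motion_det T u v w t d' HM zero3 (mk3 1 0 0) (mk3 0 1 0) (mk3 0 0 1)) as E.
  rewrite Hd in E; unfold zero3 in E; unfold3; lra.
Qed.

(** The identity has determinant 1; the moved point is what [symmetry3] requires. *)
Lemma motion_moves (T : V3 -> V3) (u v w t : V3) : motion T u v w t (-1) -> exists x, T x <> x.
Proof.
  intros HM; apply NNPP; intros N.
  assert (F : forall x, T x = x) by (intros x; apply NNPP; intros M; apply N; eauto).
  pose proof (motion_det T u v w t _ HM zero3 (mk3 1 0 0) (mk3 0 1 0) (mk3 0 0 1)) as E.
  rewrite !F in E; unfold zero3 in E; unfold3; lra.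
Qed.

Lemma num_classes_one_all {X : Type} (P : X -> Prop) (cong : X -> X -> Prop) :
  (forall x y, cong x y -> cong y x) -> (forall x y z, cong x y -> cong y z -> cong x z) ->
  num_classes P cong 1 -> forall x y, P x -> P y -> cong x y.
Proof.
  intros Hs Ht (r & _ & _ & H) x y Hx Hy.
  destruct (H x Hx) as (i & Hi & Cx); destruct (H y Hy) as (j & Hj & Cy).
  replace i with 0%nat in Cx by lia; replace j with 0%nat in Cy by lia; eauto.
Qed.

(** * Foldings along a fixed crease *)

Section Folding.

Variables (l : R) (c : R -> V3).
Hypotheses (Hl : 0 < l) (Hc : smooth3 c) (Hu : forall s, inJ l s -> norm3 (D3 c s) = 1)
  (Hinj : forall s t, inJ l s -> inJ l t -> c s = c t -> s = t)
  (Hk : forall s, inJ l s -> curv c s <> 0).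

Let C := fun x : V3 => exists s, inJ l s /\ c s = x.

(** The isometries preserving the crease, the identity included, recorded by their effect [rho] on
    the parameter and their determinant [d]. *)
Definition crease_motion (T : V3 -> V3) (rho d : R) : Prop :=
  (rho = 1 \/ rho = -1) /\ (exists u v w t, motion T u v w t d) /\
  forall s, inJ l s -> T (c s) = c (rho * s).

(* Reversing the parameter flips the binormal, hence the leading factor [rho]. *)
Definition act (rho d : R) (a : R -> R) (s : R) : R := rho * (d * a (rho * s)).

Lemma inJ_sign (rho s : R) : rho = 1 \/ rho = -1 -> inJ l s -> inJ l (rho * s).
Proof. unfold inJ; intros [-> | ->]; lra. Qed.

Lemma crease_motion_sign (T : V3 -> V3) (rho d : R) : crease_motion T rho d -> d = 1 \/ d = -1.
Proof. intros (_ & (u & v & w & t & HM) & _); apply HM. Qed.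

Lemma crease_motion_symmetry (T : V3 -> V3) (rho d : R) : crease_motion T rho d ->
  isometry3 T /\ forall y, C y <-> exists x, C x /\ T x = y.
Proof.
  intros (Hr & (u & v & w & t & HM) & E); split; [now apply (motion_isometry T u v w t d)|].
  intros y; split.
  - intros (s & Hs & <-); exists (c (rho * s)); split; [exists (rho * s); auto using inJ_sign|].
    rewrite E by auto using inJ_sign; f_equal; destruct Hr; subst; ring.
  - intros (x & (s & Hs & <-) & <-); exists (rho * s); split; auto using inJ_sign; symmetry; auto.
Qed.

Lemma crease_motion_of_isometry (T : V3 -> V3) : isometry3 T ->
  (forall y, C y <-> exists x, C x /\ T x = y) -> exists rho d, crease_motion T rho d.
Proof.
  intros HT HA; destruct (isometry3_motion T HT) as (u & v & w & t & d & HM).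
  destruct (unit_speed_unique l c (fun s => T (c s)) Hl Hc Hu) as [E|E].
  - now apply (smooth3_motion T u v w t d).
  - intros s Hs; rewrite (D3_motion T u v w t d HM c Hc), (norm3_motion T u v w t d HM); auto.
  - assumption.
  - intros s Hs; apply (HA (T (c s))); exists (c s); split; auto; exists s; auto.
  - intros s Hs; destruct (proj1 (HA (c s))) as (x & (r & Hr & <-) & Ex); [exists s; auto|].
    exists r; auto.
  - exists 1, d; split; [auto|]; split; [eauto|]; intros s Hs; rewrite Rmult_1_l; auto.
  - exists (-1), d; split; [auto|]; split; [eauto|]; intros s Hs.
    replace (-1 * s) with (- s) by ring; auto.
Qed.

Lemma crease_motion_reverses (T : V3 -> V3) (d : R) : crease_motion T (-1) d ->
  exists x, C x /\ T x <> x.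
Proof.
  intros (_ & _ & E); assert (Hs : inJ l (l / 2)) by (unfold inJ; lra).
  exists (c (l / 2)); split; [exists (l / 2); auto|].
  rewrite E by auto; intros Q; apply Hinj in Q; auto; [lra|].
  unfold inJ; lra.
Qed.

Lemma crease_motion_fixes_planar (T : V3 -> V3) (d : R) : crease_motion T 1 d ->
  (exists x, T x <> x) -> planar C.
Proof.
  intros HT Hm; apply isometry3_fixed_planar with T; auto.
  - apply (crease_motion_symmetry T 1 d HT).
  - intros y (s & Hs & <-); destruct HT as (_ & _ & E); rewrite E by auto; f_equal; ring.
Qed.

Lemma planar_crease_motion : planar C -> exists T, crease_motion T 1 (-1).
Proof.
  intros (n & e & Hn & HC); exists (reflection n e); split; [auto|]; split.
  - apply motion_of_det; [now apply reflection_isometry|].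
    intros; rewrite reflection_det by auto; ring.
  - intros s Hs; rewrite reflection_fix, Rmult_1_l; auto; apply HC; exists s; auto.
Qed.

Lemma crease_motion_even (T : V3 -> V3) (d s : R) : crease_motion T (-1) d -> inJ l s ->
  curv c (- s) = curv c s.
Proof.
  intros (_ & (u & v & w & t & HM) & E) Hs.
  rewrite <- curv_rev by auto.
  rewrite <- (curv_motion T u v w t d HM c Hc s).
  apply (curv_eq_on l); auto using smooth3_rev.
  - now apply (smooth3_motion T u v w t d).
  - intros r Hr; rewrite E by auto; f_equal; ring.
Qed.

Lemma angular_act (rho d : R) (a : R -> R) : rho = 1 \/ rho = -1 -> d = 1 \/ d = -1 ->
  angular l a -> angular l (act rho d a).
Proof.
  intros Hr Hd [Ha Hb]; split.
  - apply smooth_mult; [apply smooth_const|]; apply smooth_mult; [apply smooth_const|].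
    apply (smooth_comp a); auto; apply smooth_mult; auto using smooth_const, smooth_id.
  - intros s Hs; specialize (Hb (rho * s) (inJ_sign rho s Hr Hs)); unfold act.
    destruct Hr as [-> | ->], Hd as [-> | ->]; lra.
Qed.

(** The moved folding has crease [T (c s)] and angle [d * a]; for [rho = -1] this crease is [c]
    reversed, and reversing the parameter leads back to [c]. *)
Lemma img_crease_motion (T : V3 -> V3) (rho d : R) (a : R -> R) (eps : R) (y : V3) :
  crease_motion T rho d -> angular l a ->
  (exists x, img l (c, a) eps x /\ T x = y) <-> img l (c, act rho d a) eps y.
Proof.
  intros HT Ha; pose proof (crease_motion_sign T rho d HT) as Hd.
  destruct HT as (Hr & (u & v & w & t & HM) & E).
  pose proof (angular_act rho d a Hr Hd Ha) as [Sact _]; destruct Ha as [Sa _].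
  pose proof (smooth3_motion T u v w t d HM c Hc) as STc.
  assert (Sda : smooth (fun s => d * a s)) by (apply smooth_mult; auto using smooth_const).
  rewrite <- (img_motion T u v w t d HM c Hc l a eps y Sa).
  destruct Hr as [-> | ->].
  - apply (img_eq_on l); auto.
    + intros s Hs; rewrite E by auto; f_equal; ring.
    + intros s Hs; unfold act; rewrite !Rmult_1_l; reflexivity.
  - rewrite <- (img_rev c Hc l (act (-1) d a)) by auto.
    apply (img_eq_on l); auto using smooth3_rev.
    + intros s Hs; rewrite E by auto; f_equal; ring.
    + apply smooth_opp, (smooth_comp (act (-1) d a)); auto using smooth_opp, smooth_id.
    + intros s Hs; unfold act; replace (-1 * - s) with s by ring; ring.
Qed.

(** The crease is the set of points common to all images of small width, so a congruence preserves
    it. The moved first folding and the second then lie along the same crease and can be compared by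
    their angles. *)
Lemma congruent_iff (a b : R -> R) : angular l a -> angular l b ->
  congruent l (c, a) (c, b) <->
  exists T rho d, crease_motion T rho d /\ forall s, inJ l s -> b s = act rho d a s.
Proof.
  intros Ha Hb; split.
  - intros (T & HT & e & He & H).
    assert (Hin : forall x, C x -> forall f eps, 0 < eps -> img l (c, f) eps x)
      by (intros x (s & Hs & <-) f eps Heps; now apply crease_in_img).
    assert (HA : forall y, C y <-> exists x, C x /\ T x = y).
    { intros y; split.
      - intros Hy.
        assert (Hx : forall eps, 0 < eps < e -> exists x, img l (c, a) eps x /\ T x = y)
          by (intros eps Heps; apply H; auto; apply Hin; auto; lra).
        (* The preimage of [y] could depend on [eps]; injectivity of [T] makes it one point lying in
           every image. *)
        destruct (Hx (e / 2) ltac:(lra)) as (x & _ & Ex).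
        exists x; split; auto.
        apply (img_shrinks_to_crease l c Hl Hc Hu Hk a e x He).
        intros eps Heps; destruct (Hx eps Heps) as (x' & Hx' & Ex').
        replace x with x'; auto; apply (isometry3_inj T); auto; now rewrite Ex.
      - intros (x & Hx & <-).
        apply (img_shrinks_to_crease l c Hl Hc Hu Hk b e (T x) He).
        intros eps Heps; apply H; auto; exists x; split; auto; apply Hin; auto; lra. }
    destruct (crease_motion_of_isometry T HT HA) as (rho & d & HM).
    exists T, rho, d; split; auto.
    intros s Hs; symmetry.
    apply (img_determines_angle l c Hl Hc Hu Hinj Hk (act rho d a) b e); auto.
    + apply angular_act; auto; [apply HM | now apply (crease_motion_sign T rho d)].
    + intros eps x Heps Hx; apply H; auto; now apply (img_crease_motion T rho d).
  - intros (T & rho & d & HM & E).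
    exists T; split; [apply (crease_motion_symmetry T rho d HM)|].
    exists 1; split; [lra|]; intros eps _ y.
    rewrite (img_crease_motion T rho d a eps y HM Ha).
    apply (img_eq_on l); auto; [apply Hb|].
    apply angular_act; auto; [apply HM | now apply (crease_motion_sign T rho d)].
Qed.

Lemma congruent_eq_on (a b : R -> R) : angular l a -> angular l b ->
  (forall s, inJ l s -> a s = b s) -> congruent l (c, a) (c, b).
Proof.
  intros [Ha _] [Hb _] E; apply congruent_of_img; intros eps x; now apply (img_eq_on l).
Qed.

Variable gamma : R -> V2.
Hypotheses (Hg : smooth2 gamma) (Hgu : forall s, inJ l s -> norm2 (D2 gamma s) = 1)
  (Hginj : forall s t, inJ l s -> inJ l t -> gamma s = gamma t -> s = t).

Let Gam := fun y : V2 => exists s, inJ l s /\ gamma s = y.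
Let m := curv2 gamma.

Lemma curv_pos (s : R) : inJ l s -> 0 < curv c s.
Proof.
  intros Hs; pose proof (Hk s Hs) as H; rewrite curv_unit in * by auto.
  pose proof (norm3_pos (cross3 (D3 c s) (D3 (D3 c) s))); lra.
Qed.

(** An affine map of slope 1 or -1 sending both ends of [J] into [J] has no translation part. *)
Lemma equi_affine_sign (m1 m2 : R -> R) : equi_affine l m1 m2 ->
  exists sg, (sg = 1 \/ sg = -1) /\ forall s, inJ l s -> m2 s = m1 (sg * s).
Proof.
  intros (sg & d & Hsg & H); exists sg; split; auto.
  assert (d = 0).
  { assert (Ja : inJ l (- (l / 2))) by (unfold inJ; lra).
    assert (Jb : inJ l (l / 2)) by (unfold inJ; lra).
    destruct (H _ Ja) as [H1 _]; destruct (H _ Jb) as [H2 _].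
    unfold inJ in *; destruct Hsg as [-> | ->]; lra. }
  subst d; intros s Hs; destruct (H (sg * s) (inJ_sign sg s Hsg Hs)) as [_ E].
  rewrite <- E; f_equal; destruct Hsg as [-> | ->]; ring.
Qed.

(** Every normal form is moved to the fixed parametrization [c]. If it runs the other way, its angle
    becomes [- a (- s)] and the sign [sg] relating it to [gamma] flips. *)
Lemma inP_reduce (F : (R -> V3) * (R -> R)) : inP l C gamma F ->
  exists b, angular l b /\ congruent l F (c, b) /\
    (exists sg, (sg = 1 \/ sg = -1) /\ forall s, inJ l s -> curv c s * cos (b s) = m (sg * s)) /\
    (forall s r, inJ l s -> inJ l r -> curv c s * cos (b s) < curv c r).
Proof.
  destruct F as [cf a]; unfold inP; cbn [fst snd].
  intros (Scf & Ucf & Icf & HC & Sa & Ba & Adm & Gen).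
  destruct (equi_affine_sign _ _ Gen) as (sg & Hsg & Em); unfold mu in *.
  destruct (unit_speed_unique l c cf Hl Hc Hu Scf Ucf Hinj) as [E|E].
  - intros s Hs; apply HC; eauto.
  - intros s Hs; apply HC; exists s; auto.
  - assert (Ek : forall s, inJ l s -> curv cf s = curv c s) by (intros; now apply (curv_eq_on l)).
    exists a; split; [split; auto|]; split; [|split].
    + apply congruent_of_img; intros eps x; now apply (img_eq_on l).
    + exists sg; split; auto; intros s Hs; rewrite <- Ek by auto; now apply Em.
    + intros s r Hs Hr; rewrite <- !Ek by auto; auto.
  - assert (Ek : forall s, inJ l s -> curv cf s = curv c (- s)).
    { intros s Hs; rewrite <- curv_rev by auto; apply (curv_eq_on l); auto using smooth3_rev. }
    assert (Sb : smooth (fun s => - a (- s)))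
      by (apply smooth_opp, (smooth_comp a); auto using smooth_opp, smooth_id).
    assert (Eb : forall s, inJ l s -> curv c s * cos (- a (- s)) = curv cf (- s) * cos (a (- s)))
      by (intros s Hs; rewrite Ek, Ropp_involutive, cos_neg by auto using inJ_opp; ring).
    exists (fun s => - a (- s)); split; [|split; [|split]].
    + split; auto; intros s Hs; specialize (Ba (- s) (inJ_opp l s Hs)); lra.
    + apply congruent_of_img; intros eps x.
      rewrite <- (img_rev c Hc l (fun s => - a (- s)) eps x Sb).
      apply (img_eq_on l); auto using smooth3_rev.
      * apply smooth_opp, (smooth_comp (fun s => - a (- s))); auto using smooth_opp, smooth_id.
      * intros s Hs; rewrite !Ropp_involutive; auto.
    + exists (- sg); split; [destruct Hsg; subst; lra|].
      intros s Hs; rewrite Eb, Em by auto using inJ_opp; unfold m; f_equal; ring.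
    + intros s r Hs Hr; rewrite Eb by auto.
      replace (curv c r) with (curv cf (- r))
        by (rewrite Ek, Ropp_involutive by auto using inJ_opp; auto).
      auto using inJ_opp.
Qed.

Lemma inP_bounds : (exists F, inP l C gamma F) ->
  forall s r, inJ l s -> inJ l r -> 0 < m s < curv c r.
Proof.
  intros [F HF]; destruct (inP_reduce F HF) as (b & Hb & _ & (sg & Hsg & Em) & Adm).
  intros s r Hs Hr; pose proof (inJ_sign sg s Hsg Hs) as Hs'.
  replace (m s) with (m (sg * (sg * s))) by (f_equal; destruct Hsg as [-> | ->]; ring).
  rewrite <- Em by auto; split; [|auto].
  apply Rmult_lt_0_compat; [now apply curv_pos | now apply (angular_sin l b)].
Qed.

Hypothesis Hm : forall s r, inJ l s -> inJ l r -> 0 < m s < curv c r.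

Lemma inP_intro (b : R -> R) (sg : R) : angular l b -> sg = 1 \/ sg = -1 ->
  (forall s, inJ l s -> curv c s * cos (b s) = m (sg * s)) -> inP l C gamma (c, b).
Proof.
  intros [Sb Hb] Hsg E; unfold inP; cbn [fst snd]; unfold mu.
  repeat (split; [first [assumption | intros x; unfold C; tauto] |]).
  split.
  - intros s r Hs Hr; rewrite E by auto; apply Hm; auto using inJ_sign.
  - exists sg, 0; split; auto; intros s Hs; rewrite Rplus_0_r; split; auto using inJ_sign.
    rewrite E by auto using inJ_sign; unfold m; f_equal; destruct Hsg as [-> | ->]; ring.
Qed.

(** The sign [sg] selects [gamma] or its reversal. The angle is normalized to be positive, as the
    cosine determines it up to sign only. *)
Definition angle_for (sg : R) (A : R -> R) : Prop :=
  smooth A /\ forall s, inJ l s -> 0 < A s < PI / 2 /\ curv c s * cos (A s) = m (sg * s).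

(** The obstacle is the absolute value in [curv2]: the lower bound in [Hm] excludes zeros of the
    signed curvature [k], so on [J] it is [k] or [- k] throughout. *)
Lemma angle_for_exists (sg : R) : sg = 1 \/ sg = -1 -> exists A, angle_for sg A.
Proof.
  intros Hsg; destruct Hg as [G1 G2].
  set (k s := det2 (D2 gamma s) (D2 (D2 gamma) s)).
  assert (Sk : smooth k).
  { pose proof (smooth_Derive _ G1) as K1; pose proof (smooth_Derive _ G2) as K2.
    pose proof (smooth_Derive _ K1) as L1; pose proof (smooth_Derive _ K2) as L2.
    apply smooth_minus; apply smooth_mult; assumption. }
  assert (Ek : forall s, inJ l s -> m s = Rabs (k s)).
  { intros s Hs; unfold m, curv2; rewrite Hgu by auto; fold (k s); field. }
  assert (Hex : exists f, smooth f /\ forall s, inJ l s -> m s = f s).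
  { destruct (constant_sign l k Hl Sk) as [P|P].
    - intros s Hs Z; pose proof (Hm s s Hs Hs) as B; rewrite Ek, Z, Rabs_R0 in B by auto; lra.
    - exists k; split; auto; intros s Hs; rewrite Ek by auto; apply Rabs_pos_eq; left; auto.
    - exists (fun s => - k s); split; [now apply smooth_opp|].
      intros s Hs; rewrite Ek by auto; apply Rabs_left; auto. }
  destruct Hex as (f & Sf & Ef).
  destruct (angle_of_geodesic_curvature l c (fun s => f (sg * s)) Hl Hc Hu) as (A & SA & HA).
  - apply (smooth_comp f); auto; apply smooth_mult; auto using smooth_const, smooth_id.
  - intros s Hs; rewrite <- Ef by auto using inJ_sign; auto using inJ_sign.
  - exists A; split; auto; intros s Hs; destruct (HA s Hs) as [HA1 HA2]; split; auto.
    rewrite HA2; symmetry; apply Ef; auto using inJ_sign.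
Qed.

Lemma angle_for_angular (sg : R) (A : R -> R) : angle_for sg A -> angular l A.
Proof. intros [SA HA]; split; auto; intros s Hs; destruct (HA s Hs); lra. Qed.

Lemma cos_eq_angle (x y : R) : 0 < x < PI / 2 -> 0 < y < PI / 2 -> cos x = cos y -> x = y.
Proof.
  intros Hx Hy E; pose proof PI_RGT_0.
  destruct (Rtotal_order x y) as [L|[L|L]]; auto; exfalso;
    apply cos_decreasing_1 in L; lra.
Qed.

Lemma angle_for_eq (sg sg' s s' : R) (A B : R -> R) : angle_for sg A -> angle_for sg' B ->
  inJ l s -> inJ l s' -> curv c s = curv c s' -> (A s = B s' <-> m (sg * s) = m (sg' * s')).
Proof.
  intros [_ HA] [_ HB] Hs Hs' E.
  destruct (HA s Hs) as [PA EA]; destruct (HB s' Hs') as [PB EB].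
  pose proof (curv_pos s Hs); rewrite <- EA, <- EB, E; split; [intros ->; auto|].
  intros Q; apply cos_eq_angle; auto; apply Rmult_eq_reg_l in Q; lra.
Qed.

(** A continuous function without zeros keeps its sign on [J], so a solution cannot switch between
    the two branches of the arc cosine. *)
Lemma angular_is_angle_for (sg : R) (b A : R -> R) : angular l b -> angle_for sg A ->
  (forall s, inJ l s -> curv c s * cos (b s) = m (sg * s)) ->
  (forall s, inJ l s -> b s = A s) \/ (forall s, inJ l s -> b s = - A s).
Proof.
  intros [Sb Hb] HA E.
  destruct (constant_sign l b Hl Sb) as [P|P]; [intros s Hs; now apply Hb | left | right];
    intros s Hs; specialize (P s Hs); destruct (Hb s Hs) as [Hb' _];
    destruct HA as [_ HA]; destruct (HA s Hs) as [PA EA];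
    rewrite <- E in EA by auto; apply Rmult_eq_reg_l in EA; auto.
  - symmetry; apply cos_eq_angle; auto; lra.
  - apply Ropp_eq_reg; rewrite Ropp_involutive; symmetry; apply cos_eq_angle; auto; [lra|].
    now rewrite cos_neg.
Qed.

Variables A1 A2 : R -> R.
Hypotheses (HA1 : angle_for 1 A1) (HA2 : angle_for (-1) A2).

Let F1 := (c, A1).
Let N1 := (c, fun s => - A1 s).
Let F2 := (c, A2).
Let N2 := (c, fun s => - A2 s).

Lemma inP_four : inP l C gamma F1 /\ inP l C gamma N1 /\ inP l C gamma F2 /\ inP l C gamma N2.
Proof.
  pose proof (angle_for_angular _ _ HA1) as G1; pose proof (angle_for_angular _ _ HA2) as G2.
  destruct HA1 as [_ E1], HA2 as [_ E2].
  split; [|split; [|split]].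
  - apply (inP_intro _ 1); auto; intros s Hs; now apply E1.
  - apply (inP_intro _ 1); auto using angular_opp; intros s Hs; rewrite cos_neg; now apply E1.
  - apply (inP_intro _ (-1)); auto; intros s Hs; now apply E2.
  - apply (inP_intro _ (-1)); auto using angular_opp; intros s Hs; rewrite cos_neg; now apply E2.
Qed.

Lemma four_cover (F : (R -> V3) * (R -> R)) : inP l C gamma F ->
  congruent l F F1 \/ congruent l F N1 \/ congruent l F F2 \/ congruent l F N2.
Proof.
  intros HF; destruct (inP_reduce F HF) as (b & Hb & Cb & (sg & Hsg & Em) & _).
  pose proof (angle_for_angular _ _ HA1) as G1; pose proof (angle_for_angular _ _ HA2) as G2.
  assert (Q : forall B, angular l B -> (forall s, inJ l s -> b s = B s) -> congruent l F (c, B))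
    by (intros B HB E; eapply congruent_trans; [exact Cb | now apply congruent_eq_on]).
  destruct Hsg as [-> | ->].
  - destruct (angular_is_angle_for 1 b A1 Hb HA1 Em);
      [left | right; left]; apply Q; auto using angular_opp.
  - destruct (angular_is_angle_for (-1) b A2 Hb HA2 Em);
      [right; right; left | right; right; right]; apply Q; auto using angular_opp.
Qed.

Lemma sym_angles : has_sym2 Gam <-> forall s, inJ l s -> A1 s = A2 s.
Proof.
  assert (Hkg : forall s, inJ l s -> curv2 gamma s <> 0)
    by (intros s Hs; pose proof (Hm s s Hs Hs) as B; unfold m in B; lra).
  assert (Q : forall s, inJ l s -> (A1 s = A2 s <-> m (- s) = m s)).
  { intros s Hs; rewrite (angle_for_eq 1 (-1) s s A1 A2 HA1 HA2 Hs Hs eq_refl).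
    rewrite Rmult_1_l; replace (-1 * s) with (- s) by ring; split; auto. }
  split.
  - intros H s Hs; apply Q; auto; now apply (plane_symmetry_even l gamma).
  - intros H; apply (even_plane_symmetry l gamma); auto.
    intros s Hs; apply Q; auto.
Qed.

Lemma congruent_sym2 : has_sym2 Gam -> congruent l F1 F2 /\ congruent l N1 N2.
Proof.
  intros H; rewrite sym_angles in H.
  pose proof (angle_for_angular _ _ HA1) as G1; pose proof (angle_for_angular _ _ HA2) as G2.
  split; apply congruent_eq_on; auto using angular_opp.
  intros s Hs; now rewrite H.
Qed.

Lemma congruent_planar : planar C -> congruent l F1 N1 /\ congruent l F2 N2.
Proof.
  intros H; destruct (planar_crease_motion H) as [T HT].
  pose proof (angle_for_angular _ _ HA1) as G1; pose proof (angle_for_angular _ _ HA2) as G2.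
  split; apply congruent_iff; auto using angular_opp; exists T, 1, (-1); split; auto;
    intros s Hs; unfold act; rewrite !Rmult_1_l; ring.
Qed.

Lemma reversing_angles (T : V3 -> V3) (d s : R) : crease_motion T (-1) d -> inJ l s ->
  A2 s = A1 (- s).
Proof.
  intros HT Hs.
  apply (angle_for_eq (-1) 1 s (- s) A2 A1 HA2 HA1); auto using inJ_opp.
  - symmetry; now apply (crease_motion_even T d).
  - f_equal; ring.
Qed.

(** Here [act (-1) d A1] is [- d * A2]: a reversing rotation joins opposite signs, a reversing
    reflection equal ones. *)
Lemma congruent_reversing (T : V3 -> V3) (d : R) : crease_motion T (-1) d ->
  (congruent l F1 N2 /\ congruent l N1 F2) \/ (congruent l F1 F2 /\ congruent l N1 N2).
Proof.
  intros HT.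
  pose proof (angle_for_angular _ _ HA1) as G1; pose proof (angle_for_angular _ _ HA2) as G2.
  destruct (crease_motion_sign T _ d HT) as [-> | ->]; [left | right];
    split; apply congruent_iff; auto using angular_opp; eexists T, (-1), _;
    (split; [exact HT|]); intros s Hs; unfold act; rewrite (reversing_angles T _ s HT Hs);
    replace (-1 * s) with (- s) by ring; ring.
Qed.

Lemma has_sym3_cases : has_sym3 C -> planar C \/ exists T d, crease_motion T (-1) d.
Proof.
  intros (T & HT & Hx & HA).
  destruct (crease_motion_of_isometry T HT HA) as (rho & d & HM).
  destruct (proj1 HM) as [-> | ->]; [left | right; eauto].
  now apply (crease_motion_fixes_planar T d).
Qed.

Lemma four_classes : ~ has_sym3 C -> ~ has_sym2 Gam ->
  num_classes (inP l C gamma) (congruent l) 4.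
Proof.
  intros H3 H2.
  (* Without symmetries of the crease only [rho = 1], [d = 1] survives, and it acts trivially. *)
  assert (Hid : forall a b, angular l a -> angular l b -> congruent l (c, a) (c, b) ->
    forall s, inJ l s -> b s = a s).
  { intros a b Ha Hb Hab; apply congruent_iff in Hab; auto.
    destruct Hab as (T & rho & d & HM & E).
    destruct (crease_motion_symmetry T rho d HM) as [HT HA].
    destruct (proj1 HM) as [-> | ->].
    - destruct (crease_motion_sign T 1 d HM) as [-> | ->].
      + intros s Hs; rewrite E by auto; unfold act; rewrite !Rmult_1_l; auto.
      + exfalso; apply H3; exists T; split; auto; split; auto.
        destruct HM as (_ & (u & v & w & t & HM) & _); now apply (motion_moves T u v w t).
    - exfalso; apply H3; exists T; split; auto; split; auto.
      destruct (crease_motion_reverses T d HM) as (x & _ & Hx); eauto. }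
  pose proof (angle_for_angular _ _ HA1) as G1; pose proof (angle_for_angular _ _ HA2) as G2.
  pose proof (angular_opp l A1 G1) as G1'; pose proof (angular_opp l A2 G2) as G2'.
  pose proof (inJ_0 l Hl) as J0.
  assert (P1 : 0 < A1 0) by (now apply HA1); assert (P2 : 0 < A2 0) by (now apply HA2).
  assert (Hne : ~ forall s, inJ l s -> A1 s = A2 s) by (now rewrite <- sym_angles).
  destruct inP_four as (I1 & I2 & I3 & I4).
  exists (fun i => match i with 0 => F1 | 1 => N1 | 2 => F2 | _ => N2 end%nat); split; [|split].
  - intros [|[|[|i]]] _; auto.
  - assert (Hij : forall a b, angular l a -> angular l b -> a 0 <> b 0 ->
      ~ congruent l (c, a) (c, b))
      by (intros a b Ha Hb N Hab; apply N; symmetry; now apply (Hid a b)).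
    (* Angles of opposite sign already differ at 0; the pairs [F1], [F2] and [N1], [N2] need the
       asymmetry of [gamma]. *)
    intros [|[|[|[|i]]]] [|[|[|[|j]]]] Hi Hj N; try lia; unfold F1, F2, N1, N2;
      try (apply Hij; auto; lra); intros Hab; apply Hne; intros s Hs;
      match type of Hab with congruent _ (_, ?a) (_, ?b) =>
        pose proof (Hid a b ltac:(auto) ltac:(auto) Hab s Hs) end; simpl in *; lra.
  - intros F HF; destruct (four_cover F HF) as [H|[H|[H|H]]];
      [exists 0%nat | exists 1%nat | exists 2%nat | exists 3%nat]; split; auto.
Qed.

(** Each kind of symmetry pairs off the four forms. Planarity joins opposite signs, leaving [F1],
    [F2]; the others pair each of [F1], [N1] with one of [F2], [N2], leaving [F1], [N1]. *)
Lemma at_most_two_classes : has_sym3 C \/ has_sym2 Gam ->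
  exists k, (k <= 2)%nat /\ num_classes (inP l C gamma) (congruent l) k.
Proof.
  intros H; destruct inP_four as (I1 & I2 & I3 & I4).
  pose proof (congruent_sym l) as Sy; pose proof (congruent_trans l) as Tr.
  assert (Q : forall X Y, inP l C gamma X -> inP l C gamma Y ->
    (forall Z, Z = F1 \/ Z = N1 \/ Z = F2 \/ Z = N2 -> congruent l Z X \/ congruent l Z Y) ->
    exists k, (k <= 2)%nat /\ num_classes (inP l C gamma) (congruent l) k).
  { intros X Y HX HY HZ; apply num_classes_le_two with X Y; auto.
    intros F HF; destruct (four_cover F HF) as [D|[D|[D|D]]];
      [destruct (HZ F1) | destruct (HZ N1) | destruct (HZ F2) | destruct (HZ N2)]; eauto. }
  assert (Rf : forall X, congruent l X X) by (intros X; apply congruent_of_img; tauto).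
  destruct H as [H|H].
  - destruct (has_sym3_cases H) as [Pl | (T & d & HT)].
    + destruct (congruent_planar Pl); apply (Q F1 F2); auto.
      intros Z [-> | [-> | [-> | ->]]]; auto.
    + destruct (congruent_reversing T d HT) as [[D1 D2] | [D1 D2]]; apply (Q F1 N1); auto;
        intros Z [-> | [-> | [-> | ->]]]; auto.
  - destruct (congruent_sym2 H) as [D1 D2]; apply (Q F1 N1); auto.
    intros Z [-> | [-> | [-> | ->]]]; auto.
Qed.

Lemma one_class_intro : congruent l N1 F1 -> congruent l F2 F1 -> congruent l N2 F1 ->
  num_classes (inP l C gamma) (congruent l) 1.
Proof.
  intros E1 E2 E3; apply num_classes_one with F1; [apply inP_four|].
  intros F HF; destruct (four_cover F HF) as [D|[D|[D|D]]]; eauto using congruent_trans.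
Qed.

(** In the forward direction one well-chosen congruence reveals the symmetry: [F1] with [F2] when
    [C] is planar, where opposite signs are joined anyway, and [F1] with [N1] when it is not. *)
Lemma one_class_iff : num_classes (inP l C gamma) (congruent l) 1 <->
  (planar C /\ has_nontriv_sym3 C) \/ (planar C /\ has_sym2 Gam)
  \/ (~ planar C /\ has_pos_sym3 C /\ has_sym2 Gam).
Proof.
  pose proof (angle_for_angular _ _ HA1) as G1; pose proof (angle_for_angular _ _ HA2) as G2.
  pose proof (inJ_0 l Hl) as J0.
  assert (P1 : forall s, inJ l s -> 0 < A1 s) by (intros s Hs; now apply HA1).
  assert (P2 : forall s, inJ l s -> 0 < A2 s) by (intros s Hs; now apply HA2).
  pose proof (congruent_sym l) as Sy; pose proof (congruent_trans l) as Tr.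
  destruct inP_four as (I1 & I2 & I3 & I4).
  split.
  - intros H1.
    pose proof (num_classes_one_all _ _ Sy Tr H1) as All.
    destruct (classic (planar C)) as [Pl | Pl].
    + pose proof (All F1 F2 I1 I3) as D; apply congruent_iff in D; auto.
      destruct D as (T & rho & d & HM & E).
      destruct (crease_motion_symmetry T rho d HM) as [HT HA].
      destruct (proj1 HM) as [-> | ->].
      * right; left; split; auto; apply sym_angles; intros s Hs.
        specialize (E s Hs); specialize (P1 s Hs); specialize (P2 s Hs).
        unfold act in E; rewrite !Rmult_1_l in E.
        (* Both angles are positive, so [d = -1] is impossible and the two angles coincide. *)
        destruct (crease_motion_sign T 1 d HM) as [-> | ->]; lra.
      * left; split; auto.
        destruct (crease_motion_reverses T d HM) as (x & Cx & Hx).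
        exists T; split; [split; [|split]; eauto | eauto].
    + right; right; split; auto.
      pose proof (All F1 N1 I1 I2) as D; apply congruent_iff in D; auto using angular_opp.
      destruct D as (T & rho & d & HM & E).
      destruct (crease_motion_symmetry T rho d HM) as [HT HA].
      destruct (proj1 HM) as [-> | ->].
      (* Turning [A1] into [- A1] without reversing forces [d = -1], a non-identity isometry fixing
         the crease pointwise. *)
      * exfalso; apply Pl, (crease_motion_fixes_planar T d); auto.
        specialize (E 0 J0); specialize (P1 0 J0); unfold act in E; rewrite !Rmult_1_l in E.
        destruct (crease_motion_sign T 1 d HM) as [-> | ->]; [lra|].
        destruct HM as (_ & (u & v & w & t & HM) & _); now apply (motion_moves T u v w t).
      (* At the midpoint [s = 0], fixed by the reversal, the congruence reads
         [- A1 0 = - d * A1 0]. *)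
      * assert (Hd : d = 1).
        { destruct (crease_motion_sign T _ d HM) as [-> | ->]; auto.
          specialize (E 0 J0); pose proof (P1 0 J0); unfold act in E.
          replace (-1 * 0) with 0 in E by ring; lra. }
        subst d; split.
        -- exists T; split.
           ++ destruct (crease_motion_reverses T 1 HM) as (x & Cx & Hx).
              split; [|split]; eauto.
           ++ destruct HM as (_ & (u & v & w & t & HM) & _); intros x0 x1 x2 x3.
              rewrite (motion_det T u v w t 1 HM); ring.
        -- apply sym_angles; intros s Hs; rewrite (reversing_angles T 1 s HM Hs).
           specialize (E s Hs); unfold act in E; replace (-1 * s) with (- s) in E by ring; lra.
  - intros [[Pl (T & (HT & _ & HA) & (x & Cx & Hx))] | [[Pl S2] | (Pl & (T & (HT & Hx & HA) & Ho) & S2)]].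
    + destruct (congruent_planar Pl) as [D1 D2].
      destruct (crease_motion_of_isometry T HT HA) as (rho & d & HM).
      destruct (proj1 HM) as [-> | ->].
      { exfalso; apply Hx; destruct Cx as (s & Hs & <-).
        destruct HM as (_ & _ & E); rewrite E by auto; f_equal; ring. }
      destruct (congruent_reversing T d HM) as [[D3 D4] | [D3 D4]]; apply one_class_intro; eauto.
    + destruct (congruent_planar Pl) as [D1 D2]; destruct (congruent_sym2 S2) as [D3 D4].
      apply one_class_intro; eauto.
    + destruct (crease_motion_of_isometry T HT HA) as (rho & d & HM).
      destruct (proj1 HM) as [-> | ->].
      { exfalso; apply Pl; now apply (crease_motion_fixes_planar T d). }
      assert (Hd : d = 1).
      { destruct HM as (_ & (u & v & w & t & HM) & _).
        pose proof (motion_det T u v w t d HM zero3 (mk3 1 0 0) (mk3 0 1 0) (mk3 0 0 1)) as E.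
        rewrite Ho in E; unfold zero3 in E; unfold3; lra. }
      subst d.
      (* The reversal gives [- A1 (- s)], and [A1 (- s) = A2 s = A1 s] by the symmetry of
         [gamma]. *)
      assert (D : congruent l F1 N1).
      { apply congruent_iff; auto using angular_opp; exists T, (-1), 1; split; auto.
        intros s Hs; unfold act; pose proof (proj1 sym_angles S2 s Hs) as E.
        rewrite (reversing_angles T 1 s HM Hs) in E; rewrite E.
        replace (-1 * s) with (- s) by ring; ring. }
      destruct (congruent_sym2 S2) as [D3 D4]; apply one_class_intro; eauto.
Qed.

End Folding.

Theorem theoremB (l : R) (c : R -> V3) (gamma : R -> V2) :
  0 < l ->
  smooth3 c -> (forall s, inJ l s -> norm3 (D3 c s) = 1) ->
  (forall s t, inJ l s -> inJ l t -> c s = c t -> s = t) ->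
  (forall s, inJ l s -> curv c s <> 0) ->
  smooth2 gamma -> (forall s, inJ l s -> norm2 (D2 gamma s) = 1) ->
  (forall s t, inJ l s -> inJ l t -> gamma s = gamma t -> s = t) ->
  let C := fun x : V3 => exists s, inJ l s /\ c s = x in
  let Gam := fun y : V2 => exists s, inJ l s /\ gamma s = y in
  (exists F, inP l C gamma F) ->
  ((~ has_sym3 C /\ ~ has_sym2 Gam) -> num_classes (inP l C gamma) (congruent l) 4)
  /\ (~ (~ has_sym3 C /\ ~ has_sym2 Gam) ->
        exists k, (k <= 2)%nat /\ num_classes (inP l C gamma) (congruent l) k)
  /\ (num_classes (inP l C gamma) (congruent l) 1 <->
        (planar C /\ has_nontriv_sym3 C)
        \/ (planar C /\ has_sym2 Gam)
        \/ (~ planar C /\ has_pos_sym3 C /\ has_sym2 Gam)).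
Proof.
  intros Hl Hc Hu Hinj Hk Hg Hgu Hginj C Gam Hex.
  pose proof (inP_bounds l c Hl Hc Hu Hinj Hk gamma Hex) as Hm.
  destruct (angle_for_exists l c Hl Hc Hu gamma Hg Hgu Hm 1) as [A1 HA1]; [auto|].
  destruct (angle_for_exists l c Hl Hc Hu gamma Hg Hgu Hm (-1)) as [A2 HA2]; [auto|].
  split; [|split].
  - intros [H3 H2]; now apply (four_classes l c) with A1 A2.
  - intros H; apply (at_most_two_classes l c) with A1 A2; auto.
    destruct (classic (has_sym3 C)); [auto|]; right; apply NNPP; tauto.
  - now apply (one_class_iff l c) with A1 A2.
Qed.
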